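(* Let $\mathcal G\to\Delta$ be a smooth family of groups acting properly and freely on a smooth family $\pi\colon\mathcal X\to\Delta$. Then $\pi$ factors as $$\mathcal X\xrightarrow{\ \pi_{\mathcal O}\ }\mathcal X/\mathcal G\xrightarrow{\ \bar\pi\ }\Delta,$$ where $\pi_{\mathcal O}$ is the projection to the orbit space, and this is a factorization as a family of families: the orbit space $\mathcal X/\mathcal G$ is a smooth manifold such that $\pi_{\mathcal O}\colon\mathcal X\to\mathcal X/\mathcal G$ and $\bar\pi\colon\mathcal X/\mathcal G\to\Delta$ are both smooth families.
   Context: A smooth family over a smooth manifold $\Delta$ is a smooth manifold $\mathcal X$ with a smooth submersion $\pi\colon\mathcal X\to\Delta$, with members $\mathcal X_\delta=\pi^{-1}(\delta)$. Morphisms of families over $\Delta$ are smooth maps commuting with the projections, and products over $\Delta$ are fiber products. A family of groups is a family $\mathcal G\to\Delta$ with a smooth global section $e\colon\Delta\to\mathcal G$ and smooth maps $\mu\colon\mathcal G\times_\Delta\mathcal G\to\mathcal G$, $\iota\colon\mathcal G\to\mathcal G$ over $\Delta$ making each fiber a Lie group with identity $e(\delta)$. An action of $\mathcal G$ on $\mathcal X$ is a smooth map $\mathcal G\times_\Delta\mathcal X\to\mathcal X$ over $\Delta$, $(g,x)\mapsto g.x$, restricting for each $\delta$ to an action of $\mathcal G_\delta$ on $\mathcal X_\delta$. It is proper if $\mathcal G\times_\Delta\mathcal X\to\mathcal X\times_\Delta\mathcal X$, $(g,x)\mapsto(x,g.x)$, is a proper map, and free if $g.x=x$ implies $g\in e(\Delta)$.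 The orbit space $\mathcal X/\mathcal G$ is the quotient of $\mathcal X$ by the relation $x\sim g.x$, with the quotient topology. *)

(* Defs.v *)
From HB Require Import structures.
From mathcomp Require Import all_boot all_order all_algebra.
From mathcomp Require Import all_classical all_reals all_analysis.
From mathcomp Require Import generic_quotient.

Set Implicit Arguments.
Unset Strict Implicit.
Unset Printing Implicit Defensive.

Import Order.TTheory GRing.Theory Num.Theory.
Import numFieldNormedType.Exports.

Local Open Scope classical_set_scope.
Local Open Scope ring_scope.

(* [f] is of class C^k on [U]; meaningful for [U] open, since the derivatives
   are those of [f] as a function on the whole space. *)
Fixpoint Ck (R : realType) (n m : nat) (k : nat) (U : set 'rV[R]_n)
    (f : 'rV[R]_n -> 'rV[R]_m) : Prop :=
  match k with
  | 0 => forall x, U x -> {for x, continuous f}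
  | k'.+1 => (forall x, U x -> differentiable f x) /\
             (forall v, Ck k' U (fun x => 'D_v f x))
  end.

Definition Cinfty (R : realType) (n m : nat) (U : set 'rV[R]_n)
    (f : 'rV[R]_n -> 'rV[R]_m) : Prop := forall k, Ck k U f.

(* [cmap] and [cinv] are total functions, of which only the restrictions to
   [cdom] and to [cimg], respectively, matter. *)
Record chart (R : realType) (M : topologicalType) (n : nat) := Chart {
  cdom : set M;
  cmap : M -> 'rV[R]_n;
  cinv : 'rV[R]_n -> M }.

Section Charts.
Context (R : realType) (M : topologicalType) (n : nat).
Implicit Types c : chart R M n.

Definition cimg c : set 'rV[R]_n := cmap c @` cdom c.

Definition is_chart c : Prop :=
  [/\ open (cdom c),
      open (cimg c),
      forall x, cdom c x -> cinv c (cmap c x) = x,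
      forall x, cdom c x -> {for x, continuous (cmap c)} &
      forall y, cimg c y -> {for y, continuous (cinv c)}].

Definition compatible c c' : Prop :=
  Cinfty (cmap c @` (cdom c `&` cdom c')) (cmap c' \o cinv c).

End Charts.

Record chartedSpace (R : realType) := ChartedSpace {
  carrier :> topologicalType;
  mdim : nat;
  atlas : set (chart R carrier mdim) }.

Arguments mdim {R} _.
Arguments atlas {R} _ _.

Definition smooth_manifold (R : realType) (M : chartedSpace R) : Prop :=
  [/\ hausdorff_space M,
      @second_countable M,
      forall c, atlas M c -> is_chart c,
      forall x : M, exists2 c, atlas M c & cdom c x &
      forall c c', atlas M c -> atlas M c' -> compatible c c'].

Definition prod_chart (R : realType) (M N : topologicalType) (m n : nat)
    (c : chart R M m) (d : chart R N n) : chart R (M * N)%type (m + n) :=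
  Chart (cdom c `*` cdom d)
        (fun z => row_mx (cmap c z.1) (cmap d z.2))
        (fun v => (cinv c (lsubmx v), cinv d (rsubmx v))).

Definition prod_space (R : realType) (M N : chartedSpace R) : chartedSpace R :=
  @ChartedSpace R (M * N)%type (mdim M + mdim N)
    [set e | exists c d, [/\ atlas M c, atlas N d & e = prod_chart c d]].

Section SmoothMaps.
Context (R : realType) (M N : chartedSpace R).
Implicit Types f : M -> N.

Definition in_charts f (c : chart R M (mdim M)) (d : chart R N (mdim N)) :
  'rV[R]_(mdim M) -> 'rV[R]_(mdim N) := cmap d \o f \o cinv c.

Definition smooth_on_open (U : set M) f : Prop :=
  [/\ open U,
      forall x, U x -> {for x, continuous f} &
      forall c d, atlas M c -> atlas N d ->
        Cinfty (cmap c @` (cdom c `&` U `&` f @^-1` cdom d)) (in_charts f c d)].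

Definition smooth f : Prop := smooth_on_open setT f.

(* Smoothness on an arbitrary subset: [f] extends to a smooth map near each
   point of [S]. On an embedded submanifold [S], such as a fiber product of
   submersions, this is smoothness for the submanifold structure. *)
Definition smooth_on (S : set M) f : Prop :=
  forall x, S x -> exists U F,
    [/\ U x, smooth_on_open U F & forall y, S y -> U y -> F y = f y].

Definition submersion f : Prop :=
  smooth f /\
  forall c d x, atlas M c -> atlas N d -> cdom c x -> cdom d (f x) ->
    set_surj setT setT ('d (in_charts f c d) (cmap c x)).

End SmoothMaps.

Definition smooth_family (R : realType) (D X : chartedSpace R) (p : X -> D) :
    Prop :=
  [/\ smooth_manifold X, smooth_manifold D & submersion p].

Definition fiber_product (D X Y : Type) (p : X -> D) (q : Y -> D) :
  set (X * Y) := [set z | p z.1 = q z.2].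

(* The multiplication is a total function, but is only constrained on the fiber
   product of the family with itself. Since a map that is smooth on a set is
   smooth on its subsets, multiplication and inversion are smooth on each fiber,
   which is therefore a Lie group. *)
Record group_family (R : realType) (D G : chartedSpace R) := GroupFamily {
  gproj : G -> D;
  gone : D -> G;
  gmul : G -> G -> G;
  ginv : G -> G;
  gproj_family : smooth_family gproj;
  gone_smooth : smooth gone;
  goneP : forall d, gproj (gone d) = d;
  gmul_smooth : @smooth_on R (prod_space G G) G
    (fiber_product gproj gproj) (fun z => gmul z.1 z.2);
  gmulP : forall g h, gproj g = gproj h -> gproj (gmul g h) = gproj g;
  ginv_smooth : smooth ginv;
  ginvP : forall g, gproj (ginv g) = gproj g;
  gmulA : forall g h k, gproj g = gproj h -> gproj h = gproj k ->
    gmul g (gmul h k) = gmul (gmul g h) k;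
  gmul1g : forall g, gmul (gone (gproj g)) g = g;
  gmulg1 : forall g, gmul g (gone (gproj g)) = g;
  gmulVg : forall g, gmul (ginv g) g = gone (gproj g);
  gmulgV : forall g, gmul g (ginv g) = gone (gproj g) }.

Record family_action (R : realType) (D G X : chartedSpace R)
    (GF : group_family D G) (p : X -> D) := FamilyAction {
  act : G -> X -> X;
  act_smooth : @smooth_on R (prod_space G X) X
    (fiber_product (gproj GF) p) (fun z => act z.1 z.2);
  actP : forall g x, gproj GF g = p x -> p (act g x) = p x;
  act1 : forall x, act (gone GF (p x)) x = x;
  actM : forall g h x, gproj GF g = p x -> gproj GF h = p x ->
    act (gmul GF g h) x = act g (act h x) }.

(* [f], defined on [A] with values in [B], is proper; compactness in the
   subspaces [A] and [B] is the same as in the ambient spaces. *)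
Definition proper_map_on (S T : topologicalType) (A : set S) (B : set T)
    (f : S -> T) : Prop :=
  (forall z, A z -> B (f z)) /\
  (forall K, K `<=` B -> compact K -> compact (A `&` f @^-1` K)).

Section Actions.
Context (R : realType) (D G X : chartedSpace R).
Context (GF : group_family D G) (p : X -> D) (a : family_action GF p).

Definition proper_action : Prop :=
  @proper_map_on (G * X)%type (X * X)%type
    (fiber_product (gproj GF) p) (fiber_product p p)
    (fun z => (z.2, act a z.1 z.2)).

Definition free_action : Prop :=
  forall g x, gproj GF g = p x -> act a g x = x -> range (gone GF) g.

Definition orbit_rel : rel X :=
  fun x y => `[< exists2 g, gproj GF g = p x & y = act a g x >].

Lemma orbit_rel_equiv : equiv_class_of orbit_rel.
Proof.
split.
- by move=> x; apply/asboolP; exists (gone GF (p x)); rewrite ?goneP ?act1.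
- have orbit_sym x y : orbit_rel x y -> orbit_rel y x.
    move=> /asboolP[g gx ->]; apply/asboolP.
    exists (ginv GF g); first by rewrite ginvP actP.
    by rewrite -actM ?ginvP// gmulVg gx act1.
  by move=> x y; apply/idP/idP; exact: orbit_sym.
- move=> y x z /asboolP[g gx ->] /asboolP[h]; rewrite actP// => hx ->.
  apply/asboolP; exists (gmul GF h g); last by rewrite actM.
  by rewrite gmulP ?hx ?gx.
Qed.

Definition orbit_equiv : equiv_rel X := EquivRelPack orbit_rel_equiv.

Definition orbit_space : topologicalType :=
  quotient_topology {eq_quot orbit_equiv}%qT.

Definition orbit_proj : X -> orbit_space :=
  (\pi_({eq_quot orbit_equiv}))%qT.

End Actions.

(* Main.v *)
From HB Require Import structures.
Require Import Defs.
From mathcomp Require Import all_boot all_order all_algebra.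
From mathcomp Require Import all_classical all_reals all_analysis.
From mathcomp Require Import generic_quotient ring lra zify.

Set Implicit Arguments.
Unset Strict Implicit.
Unset Printing Implicit Defensive.

Import Order.TTheory GRing.Theory Num.Theory.
Import numFieldNormedType.Exports.

Local Open Scope classical_set_scope.
Local Open Scope ring_scope.

(** A proper and free action has slices, and the slices are the charts of the
    orbit space.

    Along the fibre over [p x0], the orbit map of a point [x0] is injective
    because the action is free, and of locally constant rank because the group
    moves any of its points to any other. Hence it is an immersion
    ([isolated_fibre_immersion], [orbit_map_immersion]): if its derivative had a
    kernel, the inverse function theorem would give a curve of group elements
    fixing [x0]. To speak of small group elements in all fibres at once, the family
    of groups is described near its identity section as a product of the base and
    of a coordinate space ([group_coordinates]), so that a coordinate [v] moves
    [x] by the element of the fibre over [p x] with coordinate [v].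

    Let [S] be a submanifold through [x0] transverse to its orbit and of
    complementary dimension. By the inverse function theorem, moving the points
    of [S] by small group elements fills a neighbourhood of [x0], each point being
    obtained once. Properness excludes that a large group element moves a point
    of [S] near [x0] to another one ([proper_near]). So a small [S] meets each nearby
    orbit exactly once ([slice_exists]), and its parameter is a coordinate on the
    orbit space. The pullback of such a coordinate to the total space is smooth on
    all orbits that meet the slice, not only near the slice, since points can be
    moved along orbits by smooth maps ([translation], [slice_cmap_smooth]). This
    gives at once the smoothness of the changes of charts and of the projection,
    while the map to the base is, in such a coordinate, the restriction of [p] to
    the slice. The projection is a submersion since translates of
    slices are sections of it, and then so is the map to the base. The orbit space
    is second countable because the projection is open, and Hausdorff because
    properness separates orbits. *)

(** * Topology *)

Lemma open_setI_preimage (S T : topologicalType) (A : set S) (B : set T)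
    (f : S -> T) : open A -> open B -> (forall x, A x -> {for x, continuous f}) ->
  open (A `&` f @^-1` B).
Proof.
move=> oA oB cf; rewrite openE => x [Ax Bfx]; apply: filterI.
  exact: (open_nbhs_nbhs (conj oA Ax)).
exact: (cf x Ax _ (open_nbhs_nbhs (conj oB Bfx))).
Qed.

Lemma near_continuous (S T : topologicalType) (f : S -> T) (P : set T) x :
  {for x, continuous f} -> (\forall y \near f x, P y) ->
  \forall z \near x, P (f z).
Proof. by move=> cf; exact: cf. Qed.

Lemma open_near (T : topologicalType) (x : T) (P : set T) :
  (\forall y \near x, P y) -> exists2 U, open U /\ U x & U `<=` P.
Proof. by move=> Px; have : nbhs x P := Px; rewrite nbhsE. Qed.

Lemma nbhs_setX (S T : topologicalType) (x : S) (y : T) A B :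
  nbhs x A -> nbhs y B -> nbhs (x, y) (A `*` B).
Proof. by move=> xA yB; exists (A, B). Qed.

Lemma continuous_pair (S T U : topologicalType) (f : S -> T) (g : S -> U) x :
  {for x, continuous f} -> {for x, continuous g} ->
  {for x, continuous (fun z => (f z, g z))}.
Proof.
exact: (@cvg_pair _ _ _ (nbhs x) (nbhs (f x)) (nbhs (g x)) _ _ _ f g).
Qed.

Lemma hausdorff_closed_diagonal (T : topologicalType) : hausdorff_space T ->
  closed [set z : T * T | z.1 = z.2].
Proof.
move=> hT [x y] /= xy; apply: hT => A B Ax By.
have [[z w] [/= <- [Az Bz]]] := xy _ (nbhs_setX Ax By).
by exists z.
Qed.

(** * Differentiability *)

Section Differentials.
Context (R : realType).

Lemma is_diff_eps (V W : normedModType R) (f : V -> W) (df : {linear V -> W})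
    (x : V) :
  continuous df ->
  (forall e, 0 < e -> \forall h \near (0 : V),
     `|f (h + x) - f x - df h| <= e * `|h|) ->
  is_diff x f df.
Proof.
move=> dfc H.
have E : f \o shift x = cst (f x) + df +o_ (0 : V) id.
  apply/eqaddoP => e e0; have := H _ e0; apply: filterS => h /=.
  by rewrite !fctE/= opprD addrA.
have D : 'd f x = df :> (V -> W) by exact: diff_unique.
apply: DiffDef => //; apply/diff_locallyP; rewrite D; split=> //.
Qed.

Lemma diff_eps (V W : normedModType R) (f : V -> W) (x : V) (e : R) :
  differentiable f x -> 0 < e ->
  \forall h \near (0 : V), `|f (h + x) - f x - 'd f x h| <= e * `|h|.
Proof.
move=> /diff_locally /eqaddoP /(_ _) H e0; have := H _ e0; apply: filterS => h /=.
by rewrite !fctE/= opprD addrA.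
Qed.

(** Differentiability is a local property; the epsilon form avoids rewriting under
    the Landau symbols of its definition. *)
Lemma near_eq_is_diff (V W : normedModType R) (f g : V -> W) (x : V) :
  (\near x, f x = g x) -> differentiable f x -> is_diff x g ('d f x).
Proof.
move=> fg df; apply: is_diff_eps; first exact: diff_continuous.
move=> e e0; have fgx := nbhs_singleton fg.
have fg0 : \forall h \near (0 : V), f (h + x) = g (h + x).
  by move: fg; rewrite (near_shift 0) /=; apply: filterS => h /=; rewrite subr0.
have := diff_eps df e0; apply: filterS2 fg0 => h E.
by rewrite -E -fgx.
Qed.

Lemma near_eq_differentiable (V W : normedModType R) (f g : V -> W) (x : V) :
  (\near x, f x = g x) -> differentiable f x -> differentiable g x.
Proof. by move=> fg df; have [] := near_eq_is_diff fg df. Qed.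

Lemma near_eq_diff (V W : normedModType R) (f g : V -> W) (x : V) :
  (\near x, f x = g x) -> differentiable f x -> 'd f x = 'd g x :> (V -> W).
Proof. by move=> fg df; have [] := near_eq_is_diff fg df. Qed.

End Differentials.

(** * Functions of class C^k *)

Section ScalarCk.
Context (R : realType) (n : nat).
Implicit Types (U : set 'rV[R]_n) (f g : 'rV[R]_n -> R^o).

(** The scalar counterpart of [Ck]. Scalar functions of class C^k form an algebra
    closed under inversion, which gives the smoothness of the inverse of a matrix. *)
Fixpoint Sk (k : nat) U f : Prop :=
  match k with
  | 0 => forall x, U x -> {for x, continuous f}
  | k'.+1 => (forall x, U x -> differentiable f x) /\
             (forall v, Sk k' U (fun x => 'D_v f x))
  end.

Lemma SkW k U f : Sk k.+1 U f -> Sk k U f.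
Proof.
elim: k f => [f [df _] x Ux|k IH f [df dvf]].
  exact/differentiable_continuous/df.
by split=> // v; apply: IH.
Qed.

Lemma near_open_eq U (W : Type) (f g : 'rV[R]_n -> W) x : open U -> U x ->
  (forall x, U x -> f x = g x) -> \near x, f x = g x.
Proof. by move=> oU Ux fg; exact: filterS (open_nbhs_nbhs (conj oU Ux)). Qed.

Lemma Sk_ext k U f g : open U -> (forall x, U x -> f x = g x) ->
  Sk k U f -> Sk k U g.
Proof.
move=> oU; elim: k f g => [f g fg cf x Ux|k IH f g fg [df dvf]].
  have fgx := near_open_eq oU Ux fg.
  rewrite /prop_for /continuous_at -(fg x Ux).
  by apply: cvg_trans; [exact: (near_eq_cvg fgx)|exact: cf].
split=> [x Ux|v].
  exact: near_eq_differentiable (near_open_eq oU Ux fg) (df x Ux).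
apply: (IH _ _ _ (dvf v)) => x Ux.
exact: near_eq_derive (near_open_eq oU Ux fg).
Qed.

Lemma Sk_cst k U (a : R) : Sk k U (cst a).
Proof.
elim: k a => [a x _|k IH a]; first exact: cst_continuous.
split=> [x _|v]; first exact: differentiable_cst.
rewrite (_ : (fun x => _) = cst 0); first exact: IH.
by apply/funext => x; rewrite derive_cst.
Qed.

Lemma SkD k U f g : open U -> Sk k U f -> Sk k U g -> Sk k U (f \+ g).
Proof.
move=> oU; elim: k f g => [f g cf cg x Ux|k IH f g [df dvf] [dg dvg]].
  exact: (cvgD (cf x Ux) (cg x Ux)).
split=> [x Ux|v]; first by apply: differentiableD; [exact: df|exact: dg].
apply: (Sk_ext oU _ (IH _ _ (dvf v) (dvg v))) => x Ux /=.
by rewrite deriveD; [by []| |]; apply: diff_derivable; [exact: df|exact: dg].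
Qed.

Lemma SkM k U f g : open U -> Sk k U f -> Sk k U g -> Sk k U (f \* g).
Proof.
move=> oU; elim: k f g => [f g cf cg x Ux|k IH f g Sf Sg].
  exact: (cvgM (cf x Ux) (cg x Ux)).
have [[df dvf] [dg dvg]] := (Sf, Sg).
split=> [x Ux|v]; first by apply: differentiableM; [exact: df|exact: dg].
have := SkD oU (IH _ _ (SkW Sf) (dvg v)) (IH _ _ (SkW Sg) (dvf v)).
apply: (Sk_ext oU) => x Ux /=.
by rewrite deriveM; [by []| |]; apply: diff_derivable; [exact: df|exact: dg].
Qed.

Lemma Sk_coord k U i : Sk k U (fun x => x ord0 i).
Proof.
case: k => [x _|k]; first exact: coord_continuous.
split=> [x _|v]; first exact: differentiable_coord.
rewrite (_ : (fun x => _) = cst (v ord0 i)); first exact: Sk_cst.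
apply/funext => x; rewrite deriveE; last exact: differentiable_coord.
have @f : {linear 'rV[R]_n -> R^o}.
  by exists (fun N : 'rV[R]_n => N ord0 i); do 2![eexists]; do ?[constructor];
     rewrite ?mxE// => ? *; rewrite ?mxE//; move=> ?; rewrite !mxE.
rewrite (_ : (fun _ => _) = f) // diff_lin//; exact: coord_continuous.
Qed.

Lemma Sk_sum k U (I : finType) (F : I -> 'rV[R]_n -> R^o) : open U ->
  (forall i, Sk k U (F i)) -> Sk k U (fun x => \sum_i F i x).
Proof.
move=> oU SF; rewrite /index_enum; elim: (Finite.enum I) => [|i s IH].
  by apply: Sk_ext (Sk_cst k U 0) => // x _; rewrite big_nil.
by apply: Sk_ext (SkD oU (SF i) IH) => // x _; rewrite big_cons.
Qed.

Lemma Sk_prod k U (I : finType) (F : I -> 'rV[R]_n -> R^o) : open U ->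
  (forall i, Sk k U (F i)) -> Sk k U (fun x => \prod_i F i x).
Proof.
move=> oU SF; rewrite /index_enum; elim: (Finite.enum I) => [|i s IH].
  by apply: Sk_ext (Sk_cst k U 1) => // x _; rewrite big_nil.
by apply: Sk_ext (SkM oU (SF i) IH) => // x _; rewrite big_cons.
Qed.

Lemma SkN k U f : open U -> Sk k U f -> Sk k U (fun x => - f x).
Proof.
move=> oU Sf; apply: Sk_ext (SkM oU (Sk_cst k U (-1)) Sf) => // x _ /=.
by rewrite mulN1r.
Qed.

Lemma SkV k U f : open U -> (forall x, U x -> f x != 0) ->
  Sk k U f -> Sk k U (fun x => (f x)^-1).
Proof.
move=> oU f0; elim: k => [cf x Ux|k IH Sf].
  exact: (cvgV (f0 x Ux) (cf x Ux)).
have [df dvf] := Sf; split=> [x Ux|v].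
  by apply: differentiableV; [exact: df|exact: f0].
have IV := IH (SkW Sf).
have := SkN oU (SkM oU (SkM oU IV IV) (dvf v)).
apply: (Sk_ext oU) => x Ux /=; rewrite deriveV ?f0//; last exact/diff_derivable/df.
by rewrite expr2 invfM scaleNr.
Qed.

End ScalarCk.

Section VectorCk.
Context (R : realType).

Lemma row_fun_sum (T : Type) m (f : T -> 'rV[R]_m) :
  f = \sum_(i < m) (fun x => f x ord0 i *: delta_mx ord0 i).
Proof. by apply/funext => x; rewrite fct_sumE -row_sum_delta. Qed.

Lemma differentiable_row n m (f : 'rV[R]_n -> 'rV[R]_m) x :
  (forall i, differentiable (fun x => f x ord0 i : R^o) x) -> differentiable f x.
Proof.
move=> df; rewrite (row_fun_sum f); apply: differentiable_sum => i.
exact: differentiableZl (df i).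
Qed.

Lemma differentiable_row_coord n m (f : 'rV[R]_n -> 'rV[R]_m) i x :
  differentiable f x -> differentiable (fun x => f x ord0 i : R^o) x.
Proof.
move=> df; apply: (@differentiable_comp _ _ _ _ f (fun y => y ord0 i : R^o)) => //.
exact: differentiable_coord.
Qed.

Lemma cvg_row (T : Type) (F : set_system T) (FF : Filter F) m (f : T -> 'rV[R]_m) (l : 'rV[R]_m) :
  (forall i, f x ord0 i @[x --> F] --> l ord0 i) -> f x @[x --> F] --> l.
Proof.
move=> cf; apply/cvgrPdist_le => e e0; near=> x.
rewrite [leLHS]/Num.Def.normr/= mx_normrE (bigmax_le _ (ltW e0))//= => -[j i] _.
rewrite !mxE/= ord1; move: i; near: x; apply: filter_forall => i.
exact: ((cvgrPdist_le _ _).1 (cf i)).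
Unshelve. all: by end_near. Qed.

Lemma derive_coord n m (f : 'rV[R]_n -> 'rV[R]_m) i x v :
  differentiable f x -> 'D_v f x ord0 i = 'D_v (fun x => f x ord0 i : R^o) x.
Proof. by move=> df; rewrite derive_mx ?mxE//; exact: diff_derivable. Qed.

(** All closure properties of [Ck] are read off the components. *)
Lemma Ck_coord n m k U (f : 'rV[R]_n -> 'rV[R]_m) : open U ->
  Ck k U f <-> forall i, Sk k U (fun x => f x ord0 i).
Proof.
move=> oU; elim: k f => [f|k IH f]; split.
- move=> cf i x Ux.
  apply: (@continuous_comp _ _ _ f (fun y => y ord0 i : R^o)); first exact: cf.
  exact: coord_continuous.
- move=> cf x Ux; apply: (@cvg_row _ (nbhs x) _ _ f) => i; exact: (cf i x Ux).
- move=> [df dvf] i; split=> [x Ux|v].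
    exact/differentiable_row_coord/df.
  have /IH/(_ i) := dvf v.
  by apply: (Sk_ext oU) => x Ux; rewrite -derive_coord//; exact: df.
- move=> Sf.
  have df x : U x -> differentiable f x.
    by move=> Ux; apply: differentiable_row => i; case: (Sf i) => + _; exact.
  split=> // v; apply/IH => i; have [_ /(_ v)] := Sf i.
  by apply: (Sk_ext oU) => x Ux; rewrite -derive_coord//; exact: df.
Qed.

Lemma derive_sum_coord m (V : normedModType R) (g : 'rV[R]_m -> V) y w :
  differentiable g y ->
  'd g y w = \sum_(i < m) w ord0 i *: 'D_(delta_mx ord0 i) g y.
Proof.
move=> dg; rewrite {1}[w]row_sum_delta linear_sum; apply: eq_bigr => i _.
by rewrite linearZ deriveE.
Qed.

(** By induction on [k] through the chain rule, which expresses the derivatives of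
    the composite by products of derivatives of [f] and of composites of
    derivatives of [g] with [f]. *)
Lemma Sk_comp n m k U W (f : 'rV[R]_n -> 'rV[R]_m) (g : 'rV[R]_m -> R^o) :
  open U -> open W -> (forall x, U x -> W (f x)) ->
  Ck k U f -> Sk k W g -> Sk k U (g \o f).
Proof.
move=> oU oW UW; elim: k f g UW => [f g UW cf cg x Ux|k IH f g UW Cf Sg].
  by apply: continuous_comp; [exact: cf|apply: cg; exact: UW].
have Sf := (Ck_coord k.+1 f oU).1 Cf.
have [[df dvf] [dg dvg]] := (Cf, Sg).
split=> [x Ux|v].
  by apply: differentiable_comp; [exact: df|apply: dg; exact: UW].
have CWf : Ck k U f by apply/(Ck_coord k f oU) => i; exact: SkW (Sf i).
have : Sk k U (fun x => \sum_(i < m) 'D_v (fun x => f x ord0 i : R^o) x *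
   ('D_(delta_mx ord0 i) g \o f) x).
  apply: Sk_sum => // i; apply: SkM => //; first by have [_] := Sf i; exact.
  exact: (IH _ _ UW CWf (dvg _)).
apply: (Sk_ext oU) => x Ux.
have dfx := df x Ux; have dgx := dg _ (UW _ Ux).
rewrite deriveE; last exact: differentiable_comp.
rewrite diff_comp//= derive_sum_coord//; apply: eq_bigr => i _.
by rewrite -derive_coord// -deriveE.
Qed.

Lemma Ck_comp n m l k U W (f : 'rV[R]_n -> 'rV[R]_m) (g : 'rV[R]_m -> 'rV[R]_l) :
  open U -> open W -> (forall x, U x -> W (f x)) ->
  Ck k U f -> Ck k W g -> Ck k U (g \o f).
Proof.
move=> oU oW UW Cf /(Ck_coord _ _ oW) Sg; apply/Ck_coord => // i.
exact: (Sk_comp oU oW UW Cf (Sg i)).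
Qed.

Lemma Ck_ext n m k U (f g : 'rV[R]_n -> 'rV[R]_m) :
  open U -> (forall x, U x -> f x = g x) -> Ck k U f -> Ck k U g.
Proof.
move=> oU fg /(Ck_coord _ _ oU) Sf; apply/Ck_coord => // i.
by apply: Sk_ext (Sf i) => // x Ux; rewrite fg.
Qed.

Lemma Ck_subset n m k U U' (f : 'rV[R]_n -> 'rV[R]_m) :
  U' `<=` U -> Ck k U f -> Ck k U' f.
Proof.
move=> sU; elim: k f => [f cf x /sU|k IH f [df dvf]]; first exact: cf.
by split=> [x /sU|v]; [exact: df|exact: IH (dvf v)].
Qed.

Lemma Ck_local n m k U (f : 'rV[R]_n -> 'rV[R]_m) :
  (forall x, U x -> exists2 U', U' x & Ck k U' f) -> Ck k U f.
Proof.
elim: k f => [f H x /H[U' U'x cf]|k IH f H]; first exact: cf.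
split=> [x /H[U' U'x [df _]]|v]; first exact: df.
by apply: IH => x /H[U' U'x [_ dvf]]; exists U' => //; exact: dvf.
Qed.

Lemma Ck_mulmx n m k U (A : 'M[R]_(n, m)) : open U -> Ck k U (fun x => x *m A).
Proof.
move=> oU; apply/Ck_coord => // i.
apply: (Sk_ext oU) (_ : Sk k U (fun x => \sum_j x ord0 j * A j i)).
  by move=> x _; rewrite mxE.
by apply: Sk_sum => // j; apply: SkM => //; [exact: Sk_coord|exact: Sk_cst].
Qed.

Lemma Ck_cst n m k U (a : 'rV[R]_m) : open U -> Ck k U (cst a : 'rV[R]_n -> _).
Proof. by move=> oU; apply/Ck_coord => // i; exact: Sk_cst. Qed.

Lemma CkD n m k U (f g : 'rV[R]_n -> 'rV[R]_m) : open U ->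
  Ck k U f -> Ck k U g -> Ck k U (fun x => f x + g x).
Proof.
move=> oU /(Ck_coord _ _ oU) Sf /(Ck_coord _ _ oU) Sg; apply/Ck_coord => // i.
by apply: Sk_ext (SkD oU (Sf i) (Sg i)) => // x _; rewrite mxE.
Qed.

Lemma Ck_row_mx n m1 m2 k U (f : 'rV[R]_n -> 'rV[R]_m1) (g : 'rV[R]_n -> 'rV[R]_m2) :
  open U -> Ck k U f -> Ck k U g -> Ck k U (fun x => row_mx (f x) (g x)).
Proof.
move=> oU /(Ck_coord _ _ oU) Sf /(Ck_coord _ _ oU) Sg; apply/Ck_coord => // i.
case: (splitP i) => j ij.
  have -> : i = lshift m2 j by exact: val_inj.
  by apply: Sk_ext (Sf j) => // x _; rewrite row_mxEl.
have -> : i = rshift m1 j by exact: val_inj.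
by apply: Sk_ext (Sg j) => // x _; rewrite row_mxEr.
Qed.

Lemma Ck_lsubmx n1 n2 k U : open U -> Ck k U (@lsubmx R 1 n1 n2).
Proof.
move=> oU; apply/Ck_coord => // i.
by apply: Sk_ext (Sk_coord _ _ (lshift _ i)) => // x _; rewrite mxE.
Qed.

Lemma Ck_rsubmx n1 n2 k U : open U -> Ck k U (@rsubmx R 1 n1 n2).
Proof.
move=> oU; apply/Ck_coord => // i.
by apply: Sk_ext (Sk_coord _ _ (rshift _ i)) => // x _; rewrite mxE.
Qed.

Lemma mulmx_continuous n m (A : 'M[R]_(n, m)) :
  continuous (fun x : 'rV[R]_n => x *m A).
Proof. by move=> x; apply: (@Ck_mulmx n m 0 setT A openT). Qed.

Lemma mulmx_diff n m (A : 'M[R]_(n, m)) x :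
  is_diff x (fun x : 'rV[R]_n => x *m A) (fun x => x *m A).
Proof.
pose f : {linear 'rV[R]_n -> 'rV[R]_m} := mulmxr A.
have cf : continuous f by exact: mulmx_continuous.
apply: DiffDef; first exact: (linear_differentiable x cf).
exact: (diff_lin x cf).
Qed.

Lemma diff_jacobian n m (f : 'rV[R]_n -> 'rV[R]_m) x v :
  'd f x v = v *m jacobian f x.
Proof. by rewrite /jacobian mul_rV_lin1. Qed.

End VectorCk.

(** * The mean value theorem for row vectors *)

Section MeanValue.
Context (R : realType).

(** The norm of a row vector is the maximum of those of its components, so that estimates
    such as the mean value inequality may be proved component by component. *)
Lemma norm_row_le n (x : 'rV[R]_n) (e : R) : 0 <= e ->
  (forall i, `|x ord0 i| <= e) -> `|x| <= e.
Proof.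
move=> e0 xe; rewrite [leLHS]/Num.Def.normr/= mx_normrE bigmax_le//= => -[j i] _.
by rewrite ord1.
Qed.

Lemma norm_coord_le n (x : 'rV[R]_n) i : `|x ord0 i| <= `|x|.
Proof.
rewrite [leRHS]/Num.Def.normr/= mx_normrE.
exact: (le_bigmax _ (fun ij => `|x ij.1 ij.2|) (ord0, i)).
Qed.

Lemma norm_row_mx_le m n (v : 'rV[R]_m) (w : 'rV[R]_n) (r : R) :
  `|v| <= r -> `|w| <= r -> `|row_mx v w| <= r.
Proof.
move=> vr wr; apply: norm_row_le => [|i]; first exact: le_trans vr.
case: (splitP i) => j ij.
  have -> : i = lshift n j by exact: val_inj.
  by rewrite row_mxEl (le_trans (norm_coord_le _ _)).
have -> : i = rshift m j by exact: val_inj.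
by rewrite row_mxEr (le_trans (norm_coord_le _ _)).
Qed.

Lemma norm_mulmx_le n m (A : 'M[R]_(n, m)) (c : R) (v : 'rV[R]_n) : 0 <= c ->
  (forall i j, `|A i j| <= c) -> `|v *m A| <= n%:R * c * `|v|.
Proof.
move=> c0 Ac; apply: norm_row_le => [|j]; first by rewrite !mulr_ge0.
rewrite mxE; apply: le_trans (ler_norm_sum _ _ _) _.
have -> : n%:R * c * `|v| = \sum_(i < n) c * `|v|.
  by rewrite sumr_const card_ord -mulrA mulr_natl.
apply: ler_sum => i _.
by rewrite normrM mulrC ler_pM// norm_coord_le.
Qed.

Lemma mean_value n (phi : 'rV[R]_n -> R^o) (x y : 'rV[R]_n) :
  (forall t : R, 0 <= t <= 1 -> differentiable phi (y + t *: (x - y))) ->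
  exists2 t : R, 0 <= t <= 1 &
    phi x - phi y = 'd phi (y + t *: (x - y)) (x - y).
Proof.
move=> dphi; pose l (t : R) : 'rV[R]_n := y + t *: (x - y).
have dl (t : R^o) : is_diff t (l : R^o -> _) ( *:%R^~ (x - y)).
  have := is_diffD (is_diff_cst y t) (is_diff_scalel t (x - y)).
  by rewrite add0r.
have D (t : R^o) : 0 <= t <= 1 ->
    is_derive t 1 (phi \o l : R^o -> R^o) ('d phi (l t) (x - y)).
  move=> t01; have dlt : differentiable (l : R^o -> _) t by have [] := dl t.
  have dp : differentiable (phi \o l : R^o -> R^o) t.
    by apply: differentiable_comp => //; exact: dphi.
  apply: DeriveDef; first exact: diff_derivable.
  rewrite deriveE// diff_comp//; last exact: dphi.
  by rewrite /= diff_val scale1r.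
have [|||t t01] := @MVT_segment R (phi \o l) (fun t => 'd phi (l t) (x - y)) 0 1.
- by [].
- by move=> t /[!in_itv]/= /andP[t0 t1]; apply: D; rewrite !ltW.
- apply: continuous_in_subspaceT => t /[!inE]/=/[!in_itv]/= t01.
  have [+ _] := D t t01.
  by move=> /derivable1_diffP/differentiable_continuous.
rewrite /l/= scale1r scale0r addr0 [y + _]addrC subrK subr0 mulr1 => E.
by exists t => //; move: t01; rewrite in_itv.
Qed.

Lemma ball_segment n (a x y : 'rV[R]_n) (r t : R) : 0 <= t <= 1 ->
  ball a r x -> ball a r y -> ball a r (y + t *: (x - y)).
Proof.
move=> /andP[t0 t1]; rewrite -ball_normE /ball_/= => ax ay.
have -> : a - (y + t *: (x - y)) = t *: (a - x) + (1 - t) *: (a - y).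
  by apply/rowP => i; rewrite !mxE; ring.
apply: le_lt_trans (ler_normD _ _) _; rewrite !normrZ ger0_norm// ger0_norm; last lra.
have [->|tn0] := eqVneq t 0; first by rewrite mul0r add0r subr0 mul1r.
have tp : 0 < t by rewrite lt_neqAle eq_sym tn0.
have : t * `|a - x| < t * r by rewrite ltr_pM2l.
have : (1 - t) * `|a - y| <= (1 - t) * r by rewrite ler_wpM2l ?subr_ge0// ltW.
lra.
Qed.

End MeanValue.

(** * The inverse function theorem *)

Section Jacobian.
Context (R : realType).

Lemma Sk_jacobian n m k U (f : 'rV[R]_n -> 'rV[R]_m) i j : open U ->
  Cinfty U f -> Sk k U (fun z => jacobian f z i j).
Proof.
move=> oU Cf; have [df dvf] := Cf k.+1.
have /Ck_coord := dvf (delta_mx ord0 i) => /(_ oU j).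
apply: (Sk_ext oU) => x Ux.
by rewrite deriveE ?diff_jacobian ?rowE; [rewrite -rowE mxE|exact: df].
Qed.

Lemma Sk_det k n q U (A : 'rV[R]_n -> 'M[R]_q) : open U ->
  (forall i j, Sk k U (fun z => A z i j)) -> Sk k U (fun z => \det (A z)).
Proof.
move=> oU SA; apply: Sk_sum => // s; apply: (SkM (f := cst _)) => //.
  exact: Sk_cst.
exact: Sk_prod.
Qed.

Lemma Sk_invmx k n q U (A : 'rV[R]_n -> 'M[R]_q) i j : open U ->
  (forall x, U x -> A x \in unitmx) ->
  (forall i j, Sk k U (fun z => A z i j)) -> Sk k U (fun z => invmx (A z) i j).
Proof.
move=> oU Au SA.
have Sadj : Sk k U (fun z => \adj (A z) i j).
  apply: (Sk_ext oU) (_ : Sk k U (fun z =>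
      (-1) ^+ (j + i) * \det (row' j (col' i (A z))))) => [x _|].
    by rewrite mxE.
  apply: (SkM (f := cst _)) => //; first exact: Sk_cst.
  apply: Sk_det => // a b.
  by apply: (Sk_ext oU) (SA (lift j a) (lift i b)) => x _; rewrite !mxE.
have Sdet : Sk k U (fun z => (\det (A z))^-1).
  by apply: SkV => [//|x /Au|]; [rewrite unitmxE unitfE|exact: Sk_det].
apply: (Sk_ext oU) (SkM oU Sdet Sadj) => x /Au Aux.
by rewrite /invmx Aux mxE.
Qed.

End Jacobian.

Section InverseNearIdentity.
Context (R : realType) (n : nat) (U : set 'rV[R]_n) (f : 'rV[R]_n -> 'rV[R]_n)
  (x0 : 'rV[R]_n).
Hypotheses (oU : open U) (Ux0 : U x0) (Cf : Cinfty U f)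
  (f1 : jacobian f x0 = 1%:M).

(* Jacobian matrices with entries this close to those of the identity matrix differ
   from it by an operator of norm at most one half. *)
Let c : R := (2 * n.+1%:R)^-1.
Let c0 : 0 < c. Proof. by rewrite invr_gt0 mulr_gt0. Qed.

Let small_jacobian : exists2 r : R, 0 < r & forall z, ball x0 r z ->
  U z /\ forall i j, `|(1%:M - jacobian f z) i j| <= c.
Proof.
have : \forall z \near x0, U z /\ forall i j, `|(1%:M - jacobian f z) i j| <= c.
  near=> z; split; first by near: z; exact: (open_nbhs_nbhs (conj oU Ux0)).
  near: z; apply: filter_forall => i; apply: filter_forall => j.
  have := @Sk_jacobian R n n 0 U f i j oU Cf x0 Ux0.
  move=> /cvgrPdist_le /(_ c c0); apply: filterS => z.
  by rewrite f1 !mxE.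
by move=> /nbhs_ballP[r r0 H]; exists r.
Unshelve. all: by end_near. Qed.

Let df z : U z -> differentiable f z.
Proof. by have [+ _] := Cf 1; exact. Qed.

Let half_bound z (w : 'rV[R]_n) :
  (forall i j, `|(1%:M - jacobian f z) i j| <= c) ->
  `|w *m (1%:M - jacobian f z)| <= 2^-1 * `|w|.
Proof.
move=> /(norm_mulmx_le w (ltW c0)) /le_trans; apply; apply: ler_wpM2r => //.
rewrite /c invfM mulrCA ler_piMr ?invr_ge0// ler_pdivrMr ?ltr0n// mul1r.
by rewrite ler_nat.
Qed.

Let contracting r : (forall z, ball x0 r z ->
    U z /\ forall i j, `|(1%:M - jacobian f z) i j| <= c) ->
  forall x y, ball x0 r x -> ball x0 r y ->
  `|(x - f x) - (y - f y)| <= 2^-1 * `|x - y|.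
Proof.
move=> Hr x y Bx By; apply: norm_row_le => [|i]; first by rewrite mulr_ge0.
pose phi (z : 'rV[R]_n) : R^o := (z - f z) ord0 i.
have dz (z : 'rV[R]_n) : U z -> is_diff z phi (fun w => (w - 'd f z w) ord0 i).
  move=> Uz; have dfz := differentiableP (df Uz).
  have dg := is_diffB (is_diff_id z) dfz.
  have dc : is_diff (z - f z) (fun y : 'rV[R]_n => y ord0 i : R^o) (fun y => y ord0 i).
    apply: DiffDef; first exact: differentiable_coord.
    have @h : {linear 'rV[R]_n -> R^o}.
      by exists (fun N : 'rV[R]_n => N ord0 i); do 2![eexists]; do ?[constructor];
        rewrite ?mxE// => ? *; rewrite ?mxE//; move=> ?; rewrite !mxE.
    by rewrite (_ : (fun _ => _) = h) // diff_lin//; exact: coord_continuous.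
  have -> : phi = (fun y : 'rV[R]_n => y ord0 i : R^o) \o (id - f) by [].
  exact: is_diff_comp.
have [|t t01 E] := @mean_value R n phi x y.
  move=> t t01; have [Uz _] := Hr _ (ball_segment t01 Bx By).
  by have [] := dz _ Uz.
have [Uz bz] := Hr _ (ball_segment t01 Bx By).
have -> : (x - f x - (y - f y)) ord0 i = phi x - phi y by rewrite /phi !mxE.
rewrite E; have [_ ->] := dz _ Uz.
rewrite diff_jacobian -{1}[x - y]mulmx1 -mulmxBr.
exact: le_trans (norm_coord_le _ _) (half_bound _ bz).
Qed.

(** Near [x0], [x - f x] contracts distances by one half. Hence [f] shrinks distances
    by a factor at most 2, so that it is injective with a Lipschitz inverse [h]; and
    it is locally surjective, since on a compact ball a point minimizing the
    distance from [f x] to [y] is a fixed point of the contraction [T]. Then [h] is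
    differentiable with derivative the inverse of the jacobian of [f] at [h y], and
    this formula raises its order of differentiability step by step. *)
Lemma inverse_near_identity : exists V W (h : 'rV[R]_n -> 'rV[R]_n),
  [/\ open V, V x0, V `<=` U, open W & Cinfty W h] /\
  (forall x, V x -> W (f x) /\ h (f x) = x) /\
  (forall y, W y -> V (h y) /\ f (h y) = y).
Proof.
have [r r0 Hr] := small_jacobian.
have ctr := contracting Hr.
have Bx0 : ball x0 r x0 by exact: ballxx.
have expand x y : ball x0 r x -> ball x0 r y -> `|x - y| <= 2 * `|f x - f y|.
  move=> Bx By; have := ctr _ _ Bx By.
  have : `|x - y| <= `|f x - f y| + `|(x - f x) - (y - f y)|.
    apply: le_trans (ler_normD _ _); rewrite le_eqVlt; apply/orP; left; apply/eqP.
    by congr (`|_|); apply/rowP => i; rewrite !mxE; ring.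
  lra.
have inj x y : ball x0 r x -> ball x0 r y -> f x = f y -> x = y.
  move=> Bx By fxy; have := expand _ _ Bx By.
  by rewrite fxy subrr normr0 mulr0 normr_le0 subr_eq0 => /eqP.
have surj y : ball (f x0) (r / 4) y -> exists2 x, ball x0 r x & f x = y.
  rewrite -ball_normE /ball_/= => yr.
  have r20 : 0 < r / 2 by rewrite divr_gt0.
  pose K : set 'rV[R]_n := closed_ball x0 (r / 2).
  have KE x : K x <-> `|x0 - x| <= r / 2 by rewrite /K closed_ballE.
  have KB x : K x -> ball x0 r x.
    by move/KE => Kx; rewrite -ball_normE /ball_/=; lra.
  (* Newton step for the equation [f x = y], with the identity as derivative *)
  pose T x := x + (y - f x).
  have TE x : T x = x - f x + y by rewrite /T addrA addrAC.
  have KT x : K x -> K (T x).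
    move=> Kx; apply/KE; have := ctr _ _ Bx0 (KB _ Kx).
    have : `|x0 - T x| <= `|(x0 - f x0) - (x - f x)| + `|f x0 - y|.
      apply: le_trans (ler_normD _ _); rewrite le_eqVlt; apply/orP; left; apply/eqP.
      by congr (`|_|); apply/rowP => i; rewrite !mxE; ring.
    by move/KE : Kx; lra.
  have [x Kx minx] : exists2 x, x \in K & forall z, z \in K -> `|y - f x| <= `|y - f z|.
    apply: (@EVT_min_rV R n (fun z => `|y - f z|)).
    - by exists x0; apply/KE; rewrite subrr normr0 ltW.
    - apply: bounded_closed_compact; last exact: closed_ball_closed.
      exists (`|x0| + r / 2); split; first exact: num_real.
      move=> M xM z /KE zK; apply/ltW/le_lt_trans/xM.
      have -> : z = x0 - (x0 - z) by rewrite opprB addrC subrK.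
      apply: le_trans (ler_normB _ _) _.
      by rewrite lerD2l.
    - apply: continuous_in_subspaceT => z /[!inE] /KB /Hr[Uz _].
      apply: (@continuous_comp _ _ _ (fun z => y - f z) (fun z => `|z|)).
        exact: (cvgB (cvg_cst _) (differentiable_continuous (df Uz))).
      exact: norm_continuous.
  rewrite inE in Kx; exists x; first by have := KB x Kx; rewrite -ball_normE.
  have := minx (T x); rewrite inE => /(_ (KT _ Kx)).
  have := ctr _ _ (KB _ (KT _ Kx)) (KB _ Kx).
  have -> : T x - f (T x) - (x - f x) = y - f (T x).
    by apply/rowP => i; rewrite !mxE; ring.
  have -> : T x - x = y - f x by apply/rowP => i; rewrite !mxE; ring.
  move=> A B; have : `|y - f x| <= 0 by have := le_trans B A; lra.
  by rewrite normr_le0 subr_eq0 => /eqP.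
have r40 : 0 < r / 4 by rewrite divr_gt0.
pose W : set 'rV[R]_n := ball (f x0) (r / 4).
have oW : open W by exact: ball_open.
pose V : set 'rV[R]_n := ball x0 r `&` f @^-1` W.
have [h hP] : {h & forall y, W y -> ball x0 r (h y) /\ f (h y) = y}.
  apply: (@choice _ _ (fun y z => W y -> ball x0 r z /\ f z = y)) => y.
  have [/surj[x Bx fx]|nWy] := pselect (W y); first by exists x.
  by exists 0.
have hf x : V x -> h (f x) = x.
  by move=> [Bx Wfx]; have [Bh fh] := hP _ Wfx; exact: inj.
have oV : open V.
  apply: open_setI_preimage => //; first exact: ball_open.
  by move=> x /Hr[Ux _]; exact: (differentiable_continuous (df Ux)).
have hlip y z : W y -> W z -> `|h y - h z| <= 2 * `|y - z|.
  move=> Wy Wz; have [By Ey] := hP _ Wy; have [Bz Ez] := hP _ Wz.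
  by have := expand _ _ By Bz; rewrite Ey Ez.
have Ju z : ball x0 r z -> jacobian f z \in unitmx.
  move=> /Hr[_ bz]; rewrite -row_free_unit; apply/inj_row_free => v vJ.
  have := half_bound v bz; rewrite mulmxBr mulmx1 vJ subr0.
  move=> H; have : `|v| <= 0 by lra.
  by rewrite normr_le0 => /eqP.
have hc y : W y -> {for y, continuous h}.
  move=> Wy; apply/(@cvgrPdist_le _ _ _ (nbhs y)) => e e0.
  have e20 : 0 < e / 2 by rewrite divr_gt0.
  near=> z.
  have Wz : W z by near: z; exact: (open_nbhs_nbhs (conj oW Wy)).
  apply: le_trans (hlip _ _ Wy Wz) _.
  have : `|y - z| <= e / 2 by near: z; exact: (@cvgr_dist_le _ _ _ (nbhs y) _ id y (@cvg_id _ _) _ e20).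
  lra.
have dh y : W y -> is_diff y h (fun v => v *m invmx (jacobian f (h y))).
  move=> Wy; have [Bh fh] := hP _ Wy; have [Uh _] := Hr _ Bh.
  set A := invmx _; pose dA : {linear 'rV[R]_n -> 'rV[R]_n} := mulmxr A.
  have dAc : continuous dA by exact: mulmx_continuous.
  apply: (@is_diff_eps _ _ _ h dA y dAc) => e e0.
  have [k k0 Ak] := linear_lipschitz dAc.
  have e'0 : 0 < e / (2 * k) by rewrite divr_gt0// mulr_gt0.
  have Hsmall := diff_eps (df Uh) e'0.
  have tends : (h (v + y) - h y) @[v --> (0 : 'rV[R]_n)] --> (0 : 'rV[R]_n).
    have cvy : v + y @[v --> (0 : 'rV[R]_n)] --> y.
      have := @cvgD _ _ _ (nbhs (0 : 'rV[R]_n)) _ id (cst y) 0 y (@cvg_id _ _) (cvg_cst _).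
      by rewrite add0r; apply.
    have := cvgB (cvg_comp _ _ cvy (hc y Wy)) (@cvg_cst _ (h y) _ (nbhs (0 : 'rV[R]_n)) _).
    by rewrite subrr => H; exact: (H (nbhs_filter _) (nbhs_filter _)).
  have {}Hsmall : \forall v \near (0 : 'rV[R]_n),
      `|f (h (v + y) - h y + h y) - f (h y) - 'd f (h y) (h (v + y) - h y)|
      <= e / (2 * k) * `|h (v + y) - h y| := tends _ Hsmall.
  have Wn : \forall v \near (0 : 'rV[R]_n), W (v + y).
    have : \forall z \near y, W z := open_nbhs_nbhs (conj oW Wy).
    by rewrite (near_shift 0) /=; apply: filterS => v /=; rewrite subr0.
  near=> v.
  have Wvy : W (v + y) by near: v; exact: Wn.
  have [_ fv] := hP _ Wvy.
  have : `|f (h (v + y) - h y + h y) - f (h y) - 'd f (h y) (h (v + y) - h y)|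
      <= e / (2 * k) * `|h (v + y) - h y|.
    by near: v; exact: Hsmall.
  set u := h (v + y) - h y; rewrite {1}/u subrK fv fh addrK diff_jacobian => Hu.
  have -> : u - dA v = dA (u *m jacobian f (h y) - v).
    by rewrite /dA/= mulmxBl -mulmxA mulmxV ?mulmx1//; exact: Ju.
  apply: le_trans (Ak _) _; rewrite distrC.
  have : k * `|v - u *m jacobian f (h y)| <= k * (e / (2 * k) * `|u|).
    by rewrite ler_pM2l.
  have -> : k * (e / (2 * k) * `|u|) = e / 2 * `|u|.
    by field; rewrite gt_eqF.
  have := hlip _ _ Wvy Wy; rewrite -/u addrK => u2.
  have : e / 2 * `|u| <= e / 2 * (2 * `|v|) by rewrite ler_pM2l ?divr_gt0.
  lra.
have Ch k : Ck k W h.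
  elim: k => [|k IH]; first exact: hc.
  split=> [y Wy|v]; first by have [] := dh _ Wy.
  apply/Ck_coord => // i.
  have : Sk k W (fun y => \sum_j v ord0 j *
      ((fun z => invmx (jacobian f z) j i) \o h) y).
    apply: Sk_sum => // j; apply: (SkM (f := cst _)) => //; first exact: Sk_cst.
    apply: (@Sk_comp _ _ _ _ _ V) => // [y Wy|].
      by have [? E] := hP _ Wy; split=> //=; rewrite E.
    apply: Sk_invmx => // [x [/Ju]//|a b].
    apply: Sk_jacobian => // k'; apply: Ck_subset (Cf k').
    by move=> x [/Hr[]].
  apply: (Sk_ext oW) => y Wy.
  have [dhy E] := dh _ Wy.
  by rewrite deriveE// E mxE.
exists V, W, h; split; last split.
- split=> //; first by split=> //=; exact: ballxx.
  by move=> x [/Hr[]].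
- by move=> x Vx; split; [case: Vx|exact: hf].
- by move=> y Wy; have [Bh fh] := hP _ Wy; split=> //; split=> //=; rewrite fh.
Unshelve. all: by end_near. Qed.

End InverseNearIdentity.

Section InverseFunction.
Context (R : realType).

(** Matrices act on row vectors from the right, whence the order of the factors. *)
Lemma jacobian_comp n m l (f : 'rV[R]_n -> 'rV[R]_m) (g : 'rV[R]_m -> 'rV[R]_l) x :
  differentiable f x -> differentiable g (f x) ->
  jacobian (g \o f) x = jacobian f x *m jacobian g (f x).
Proof.
move=> df dg; apply/row_matrixP => i.
by rewrite !rowE mulmxA -!diff_jacobian diff_comp.
Qed.

Lemma jacobian_mulmx n m (A : 'M[R]_(n, m)) x :
  jacobian (fun x : 'rV[R]_n => x *m A) x = A.
Proof.
apply/row_matrixP => i; rewrite !rowE -diff_jacobian.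
by have [_ ->] := mulmx_diff A x.
Qed.

(** The inverse [B] of the jacobian is part of the data, so that the dimensions of
    the source and of the target need not be syntactically equal. The case of
    [f] followed by [B] is that of a jacobian equal to 1. *)
Theorem inverse_function n m (U : set 'rV[R]_n) (f : 'rV[R]_n -> 'rV[R]_m) x0
    (B : 'M[R]_(m, n)) : open U -> U x0 -> Cinfty U f ->
  jacobian f x0 *m B = 1%:M -> B *m jacobian f x0 = 1%:M ->
  exists V W (h : 'rV[R]_m -> 'rV[R]_n),
  [/\ open V, V x0, V `<=` U, open W & Cinfty W h] /\
  (forall x, V x -> W (f x) /\ h (f x) = x) /\
  (forall y, W y -> V (h y) /\ f (h y) = y).
Proof.
move=> oU Ux0 Cf JB BJ; pose F x := f x *m B.
have df : differentiable f x0 by have [+ _] := Cf 1; exact.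
have CF : Cinfty U F.
  move=> k; apply: (@Ck_comp _ _ _ _ _ _ setT f (fun y => y *m B)) => //.
    exact: openT.
  by apply: Ck_mulmx; exact: openT.
have F1 : jacobian F x0 = 1%:M.
  have dB : differentiable (fun y : 'rV[R]_m => y *m B) (f x0).
    by have [] := mulmx_diff B (f x0).
  by rewrite (jacobian_comp df dB) jacobian_mulmx.
have [V [W [h [[oV Vx0 VU oW Ch] [HV HW]]]]] := inverse_near_identity oU Ux0 CF F1.
pose W' := [set y : 'rV[R]_m | W (y *m B)].
have oW' : open W'.
  have := open_setI_preimage openT oW (fun x _ => @mulmx_continuous R m n B x).
  by rewrite setTI.
exists V, W', (fun y => h (y *m B)); split; [split=> // k|split].
- by apply: (@Ck_comp _ _ _ _ _ _ W (fun y => y *m B) h) => //; exact: Ck_mulmx.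
- by move=> x /HV.
- move=> y /HW[Vh Fh]; split=> //.
  by rewrite -[LHS]mulmx1 -BJ mulmxA -/(F _) Fh -mulmxA BJ mulmx1.
Qed.

End InverseFunction.

(** * Germs of smooth maps *)

Section Germs.
Context (R : realType).
Implicit Types n m l : nat.

(** Smoothness near a point. It is stable under composition without any bookkeeping
    of domains. *)
Definition germ n m (f : 'rV[R]_n -> 'rV[R]_m) (x : 'rV[R]_n) : Prop :=
  exists U, [/\ open U, U x & Cinfty U f].

Lemma germ_near n m (f : 'rV[R]_n -> 'rV[R]_m) x :
  germ f x -> \near x, germ f x.
Proof.
move=> [U [oU Ux Cf]]; have := open_nbhs_nbhs (conj oU Ux).
by apply: filterS => y Uy; exists U.
Qed.

Lemma germ_differentiable n m (f : 'rV[R]_n -> 'rV[R]_m) x :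
  germ f x -> differentiable f x.
Proof. by move=> [U [_ Ux /(_ 1)[+ _]]]; exact. Qed.

Lemma germ_continuous n m (f : 'rV[R]_n -> 'rV[R]_m) x :
  germ f x -> {for x, continuous f}.
Proof. by move=> /germ_differentiable/differentiable_continuous. Qed.

Lemma germ_comp n m l (f : 'rV[R]_n -> 'rV[R]_m) (g : 'rV[R]_m -> 'rV[R]_l) x :
  germ f x -> germ g (f x) -> germ (g \o f) x.
Proof.
move=> [U [oU Ux Cf]] [W [oW Wfx Cg]].
have oUW : open (U `&` f @^-1` W).
  by apply: open_setI_preimage => // y Uy; exact: (Cf 0 y Uy).
exists (U `&` f @^-1` W); split=> // k.
apply: (@Ck_comp _ _ _ _ _ _ W f g) => //; first by move=> y [].
by apply: Ck_subset (Cf k) => y [].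
Qed.

Lemma germ_ext n m (f g : 'rV[R]_n -> 'rV[R]_m) x :
  (\near x, f x = g x) -> germ f x -> germ g x.
Proof.
move=> fgx; have : nbhs x [set y | f y = g y] := fgx.
rewrite nbhsE => -[A [oA Ax] fg] [U [oU Ux Cf]].
have oUA : open (U `&` A) by exact: openI.
exists (U `&` A); split=> // k; apply: (Ck_ext oUA (f := f)).
  by move=> y [_ /fg].
by apply: Ck_subset (Cf k) => y [].
Qed.

Lemma germ_row_mx n m1 m2 (f : 'rV[R]_n -> 'rV[R]_m1) (g : 'rV[R]_n -> 'rV[R]_m2) x :
  germ f x -> germ g x -> germ (fun x => row_mx (f x) (g x)) x.
Proof.
move=> [U [oU Ux Cf]] [V [oV Vx Cg]]; exists (U `&` V).
split=> [||k]; [exact: openI|by []|].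
apply: Ck_row_mx; first exact: openI.
  by apply: Ck_subset (Cf k) => y [].
by apply: Ck_subset (Cg k) => y [].
Qed.

Lemma germD n m (f g : 'rV[R]_n -> 'rV[R]_m) x :
  germ f x -> germ g x -> germ (fun x => f x + g x) x.
Proof.
move=> [U [oU Ux Cf]] [V [oV Vx Cg]]; exists (U `&` V).
split=> [||k]; [exact: openI|by []|].
apply: CkD; first exact: openI.
  by apply: Ck_subset (Cf k) => y [].
by apply: Ck_subset (Cg k) => y [].
Qed.

Lemma germ_mulmx n m (A : 'M[R]_(n, m)) x : germ (fun x => x *m A) x.
Proof. by exists setT; split=> [||k]//; [|apply: Ck_mulmx]; exact: openT. Qed.

Lemma germ_cst n m (a : 'rV[R]_m) x : germ (cst a : 'rV[R]_n -> _) x.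
Proof. by exists setT; split=> [||k]//; [|apply: Ck_cst]; exact: openT. Qed.

Lemma germ_id n x : germ (@id 'rV[R]_n) x.
Proof.
by apply: germ_ext (germ_mulmx 1%:M x); apply: (@filterE _ (nbhs x)) => y; rewrite mulmx1.
Qed.

Lemma germ_lsubmx n1 n2 x : germ (@lsubmx R 1 n1 n2) x.
Proof. by exists setT; split=> [||k]//; [|apply: Ck_lsubmx]; exact: openT. Qed.

Lemma germ_rsubmx n1 n2 x : germ (@rsubmx R 1 n1 n2) x.
Proof. by exists setT; split=> [||k]//; [|apply: Ck_rsubmx]; exact: openT. Qed.

Lemma Cinfty_germ n m U (f : 'rV[R]_n -> 'rV[R]_m) :
  (forall x, U x -> germ f x) -> Cinfty U f.
Proof. by move=> H k; apply: Ck_local => x /H[V [_ Vx /(_ k)]]; exists V. Qed.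

Lemma germ_inverse n m (f : 'rV[R]_n -> 'rV[R]_m) x0 (B : 'M[R]_(m, n)) :
  germ f x0 -> jacobian f x0 *m B = 1%:M -> B *m jacobian f x0 = 1%:M ->
  exists h : 'rV[R]_m -> 'rV[R]_n, [/\ germ h (f x0), h (f x0) = x0,
    \near x0, h (f x0) = x0 & \forall y \near f x0, f (h y) = y].
Proof.
move=> [U [oU Ux Cf]] JB BJ.
have [V [W [h [[oV Vx0 VU oW Ch] [HV HW]]]]] := inverse_function oU Ux Cf JB BJ.
have [Wf hf] := HV _ Vx0; exists h; split=> //.
- by exists W.
- by apply: filterS (open_nbhs_nbhs (conj oV Vx0)) => x /HV[].
- by apply: filterS (open_nbhs_nbhs (conj oW Wf)) => x /HW[].
Qed.

End Germs.

(** * Smooth maps between manifolds *)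

Section ChartTheory.
Context (R : realType) (M : topologicalType) (n : nat) (c : chart R M n).
Hypothesis cc : is_chart c.

Lemma chartK x : cdom c x -> cinv c (cmap c x) = x.
Proof. by case: cc => _ _ + _ _; exact. Qed.

Lemma cimg_cmap x : cdom c x -> cimg c (cmap c x).
Proof. by move=> cx; exists x. Qed.

Lemma cdom_cinv y : cimg c y -> cdom c (cinv c y).
Proof. by move=> [x cx <-]; rewrite chartK. Qed.

Lemma cinvK y : cimg c y -> cmap c (cinv c y) = y.
Proof. by move=> [x cx <-]; rewrite chartK. Qed.

Lemma near_cdom x : cdom c x -> \near x, cdom c x.
Proof. by case: cc => oc _ _ _ _ cx; exact: (open_nbhs_nbhs (conj oc cx)). Qed.

Lemma near_cimg y : cimg c y -> \near y, cimg c y.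
Proof. by case: cc => _ oc _ _ _ cy; exact: (open_nbhs_nbhs (conj oc cy)). Qed.

Lemma cmap_continuous x : cdom c x -> {for x, continuous (cmap c)}.
Proof. by case: cc => _ _ _ + _; exact. Qed.

Lemma cinv_continuous y : cimg c y -> {for y, continuous (cinv c)}.
Proof. by case: cc => _ _ _ _; exact. Qed.

Lemma cinv_continuous_cmap x : cdom c x ->
  cinv c y @[y --> cmap c x] --> x.
Proof.
move=> cx; rewrite -[X in _ --> X](chartK cx).
exact/cinv_continuous/cimg_cmap.
Qed.

Lemma near_cinv x (P : set M) : cdom c x -> (\forall z \near x, P z) ->
  \forall y \near cmap c x, P (cinv c y).
Proof. by move=> cx; exact: cinv_continuous_cmap. Qed.

Lemma chart_image_open (U : set M) : open U -> open (cmap c @` (cdom c `&` U)).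
Proof.
move=> oU; have -> : cmap c @` (cdom c `&` U) = cimg c `&` cinv c @^-1` U.
  apply/seteqP; split=> [_ [x [cx Ux] <-]|y [cy Uy]].
    by split; [exact: cimg_cmap|rewrite /= chartK].
  by exists (cinv c y); [split=> //; exact: cdom_cinv|exact: cinvK].
apply: open_setI_preimage => //; first by case: cc.
exact: cinv_continuous.
Qed.

End ChartTheory.

Section SmoothAt.
Context (R : realType).

(** The part of the definition of a manifold that the calculus of smooth maps needs.
    In contrast with the separation and countability axioms, it passes to products
    without effort. *)
Definition smooth_atlas (M : chartedSpace R) : Prop :=
  [/\ forall c, atlas M c -> is_chart c,
      forall x : M, exists2 c, atlas M c & cdom c x &
      forall c c', atlas M c -> atlas M c' -> compatible c c'].

Lemma smooth_manifold_atlas M : smooth_manifold M -> smooth_atlas M.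
Proof. by case. Qed.

Definition smooth_at (M N : chartedSpace R) (f : M -> N) (x : M) : Prop :=
  exists U, U x /\ smooth_on_open U f.

Section Criterion.
Context (M N : chartedSpace R) (aM : smooth_atlas M) (aN : smooth_atlas N).
Implicit Types (f g : M -> N) (x : M).

Lemma transition_germ (L : chartedSpace R) (aL : smooth_atlas L)
    (c c' : chart R L (mdim L)) (x : L) :
  atlas L c -> atlas L c' -> cdom c x -> cdom c' x ->
  germ (cmap c' \o cinv c) (cmap c x).
Proof.
case: aL => ch _ co Lc Lc' cx c'x.
exists (cmap c @` (cdom c `&` cdom c')); split; last exact: co.
  by apply: (chart_image_open (ch _ Lc)); have [] := ch _ Lc'.
by exists x.
Qed.

Lemma smooth_at_germ f x c d : smooth_at f x ->
  atlas M c -> atlas N d -> cdom c x -> cdom d (f x) ->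
  germ (in_charts f c d) (cmap c x).
Proof.
case: aM => chM _ _; case: aN => chN _ _.
move=> [U [Ux [oU cf Cf]]] Mc Nd cx dfx.
exists (cmap c @` (cdom c `&` U `&` f @^-1` cdom d)); split; last exact: Cf.
  rewrite -setIA; apply: (chart_image_open (chM _ Mc)).
  by apply: open_setI_preimage => //; have [] := chN _ Nd.
by exists x.
Qed.

Lemma smooth_at_continuous f x : smooth_at f x -> {for x, continuous f}.
Proof. by move=> [U [Ux [_ + _]]]; exact. Qed.

Lemma smooth_at_near f x : smooth_at f x -> \near x, smooth_at f x.
Proof.
move=> [U [Ux sf]]; have [oU _ _] := sf.
by apply: filterS (open_nbhs_nbhs (conj oU Ux)) => y Uy; exists U.
Qed.

(** By compatibility of charts, one pair of charts is enough to test smoothness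
    near a point: continuity at [x] provides a neighbourhood mapped into the domain
    of [d], on which the continuity of [f] follows from that of its expression in
    the charts. *)
Lemma germ_smooth_at f x c d : {for x, continuous f} ->
  atlas M c -> atlas N d -> cdom c x -> cdom d (f x) ->
  germ (in_charts f c d) (cmap c x) -> smooth_at f x.
Proof.
case: (aM) => chM _ _; case: (aN) => chN _ _.
move=> cf Mc Nd cx dfx [B [oB Bcx Cf]].
have [hc hd] := (chM _ Mc, chN _ Nd).
have : nbhs x (f @^-1` cdom d) by exact: (cf _ (near_cdom hd dfx)).
rewrite nbhsE => -[A [oA Ax] Ad].
pose U := (cdom c `&` cmap c @^-1` B) `&` A.
have oU : open U.
  apply: openI => //; apply: open_setI_preimage => //; first by case: hc.
  exact: cmap_continuous.
have gU z : U z -> germ (in_charts f c d) (cmap c z).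
  by move=> [[cz Bz] _]; exists B.
have cU z : U z -> {for z, continuous f}.
  move=> Uz; have [[cz Bz] Az] := Uz; have dfz := Ad _ Az.
  have Ez : in_charts f c d (cmap c z) = cmap d (f z).
    by rewrite /in_charts/= chartK.
  have E : \forall w \near z, cinv d (in_charts f c d (cmap c w)) = f w.
    apply: filterS (open_nbhs_nbhs (conj oU Uz)) => w [[cw _] Aw].
    by rewrite /in_charts/= (chartK hc)// (chartK hd)//; exact: Ad.
  rewrite /prop_for /continuous_at -(nbhs_singleton E).
  apply: cvg_trans; first exact: (near_eq_cvg E).
  apply: (@continuous_comp _ _ _ (in_charts f c d \o cmap c) (cinv d)).
    apply: continuous_comp; first exact: cmap_continuous.
    exact/germ_continuous/gU.
  by rewrite /= Ez; apply: (cinv_continuous hd); exact: cimg_cmap.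
exists U; split; first by split.
split=> // c' d' Mc' Nd'; apply: Cinfty_germ => _ [z [[c'z Uz] d'fz] <-].
have [[cz Bz] Az] := Uz; have dfz := Ad _ Az.
have [hc' hd'] := (chM _ Mc', chN _ Nd').
have g1 := transition_germ aM Mc' Mc c'z cz.
have g2 : germ (in_charts f c d) ((cmap c \o cinv c') (cmap c' z)).
  by rewrite /= chartK//; exact: gU.
have g3 : germ (cmap d' \o cinv d) ((in_charts f c d \o (cmap c \o cinv c')) (cmap c' z)).
  rewrite /in_charts/= (chartK hc')// (chartK hc)//.
  exact: (transition_germ aN Nd Nd' dfz d'fz).
apply: germ_ext (germ_comp (germ_comp g1 g2) g3).
have : \forall w \near z, cdom c w /\ cdom d (f w).
  by apply: filterS (open_nbhs_nbhs (conj oU Uz)) => w [[cw _] /Ad].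
move/(near_cinv hc' c'z); apply: filterS => w [cw dw].
by rewrite /in_charts/= (chartK hc)// (chartK hd).
Qed.

Lemma smooth_at_ext f g x : (\near x, f x = g x) -> smooth_at f x -> smooth_at g x.
Proof.
move=> fg sf; have fgx := nbhs_singleton fg.
case: (aM) => chM coM _; case: (aN) => chN coN _.
have [c Mc cx] := coM x; have [d Nd dfx] := coN (f x).
apply: (@germ_smooth_at _ _ c d) => //.
- rewrite /prop_for /continuous_at -fgx.
  by apply: cvg_trans; [exact: (near_eq_cvg fg)|exact: smooth_at_continuous].
- by rewrite -fgx.
- apply: germ_ext (smooth_at_germ sf Mc Nd cx dfx).
  have := near_cinv (chM _ Mc) cx fg.
  by apply: filterS => w; rewrite /in_charts/= => ->.
Qed.

Lemma smooth_smooth_at f x : smooth f -> smooth_at f x.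
Proof. by exists setT. Qed.

Lemma smooth_at_open (U : set M) f : open U -> (forall x, U x -> smooth_at f x) ->
  smooth_on_open U f.
Proof.
move=> oU sf; split=> // [x /sf/smooth_at_continuous//|c d Mc Nd].
apply: Cinfty_germ => _ [x [[cx Ux] dfx] <-].
exact: smooth_at_germ (sf x Ux) Mc Nd cx dfx.
Qed.

End Criterion.

Lemma smooth_at_comp (M N P : chartedSpace R) (f : M -> N) (g : N -> P) x :
  smooth_atlas M -> smooth_atlas N -> smooth_atlas P ->
  smooth_at f x -> smooth_at g (f x) -> smooth_at (g \o f) x.
Proof.
move=> aM aN aP sf sg.
case: (aM) => chM coM _; case: (aN) => chN coN _; case: (aP) => chP coP _.
have [c Mc cx] := coM x; have [d Nd dfx] := coN (f x).
have [e Pe egx] := coP (g (f x)).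
apply: (germ_smooth_at aM aP (c := c) (d := e)) => //.
  by apply: continuous_comp; exact: smooth_at_continuous.
have g1 := smooth_at_germ aM aN sf Mc Nd cx dfx.
have g2 : germ (in_charts g d e) (in_charts f c d (cmap c x)).
  by rewrite {2}/in_charts/= (chartK (chM _ Mc))//; exact: smooth_at_germ.
apply: germ_ext (germ_comp g1 g2).
have : \forall w \near x, cdom d (f w).
  exact: (smooth_at_continuous sf (near_cdom (chN _ Nd) dfx)).
move/(near_cinv (chM _ Mc) cx); apply: filterS => w dw.
by rewrite /in_charts/= (chartK (chN _ Nd)).
Qed.

Lemma smooth_at_id (M : chartedSpace R) (x : M) : smooth_atlas M -> smooth_at id x.
Proof.
move=> aM; exists setT; split=> //; split=> [|y _|c d Mc Md].
- exact: openT.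
- exact: cvg_id.
- apply: Cinfty_germ => _ [z [[cz _] dz] <-].
  exact: transition_germ.
Qed.

Lemma smooth_at_cst (M N : chartedSpace R) (x : M) (y : N) :
  smooth_atlas M -> smooth_atlas N -> smooth_at (fun _ : M => y) x.
Proof.
move=> aM aN; case: (aM) => chM coM _; case: (aN) => chN coN _.
have [c Mc cx] := coM x; have [d Nd dy] := coN y.
apply: (germ_smooth_at aM aN (c := c) (d := d)) => //; first exact: cst_continuous.
exact: germ_cst.
Qed.

End SmoothAt.

Section Euclid.
Context (R : realType).

(** With this manifold, charts and parametrizations are themselves smooth maps, and
    the smoothness of maps built from them is obtained by composition. *)
Definition euclid (n : nat) : chartedSpace R :=
  @ChartedSpace R 'rV[R]_n n [set Chart setT id id].

Lemma euclid_atlas n : smooth_atlas (euclid n).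
Proof.
split=> [_ ->|x|_ _ -> ->].
- split=> //=; first exact: openT.
  + by rewrite /cimg/= image_id; exact: openT.
  + by move=> x _; exact: cvg_id.
  + by move=> x _; exact: cvg_id.
- by exists (Chart setT id id).
- by apply: Cinfty_germ => x _; exact: germ_id.
Qed.

Lemma smooth_at_euclid n m (f : euclid n -> euclid m) x :
  smooth_at f x <-> germ (f : 'rV[R]_n -> 'rV[R]_m) x.
Proof.
split=> [sf|gf].
  exact: (smooth_at_germ (euclid_atlas n) (euclid_atlas m) sf (erefl _) (erefl _)).
apply: (germ_smooth_at (euclid_atlas n) (euclid_atlas m)
  (c := Chart setT id id) (d := Chart setT id id)) => //.
exact: (@germ_continuous R n m f x gf).
Qed.

Lemma smooth_at_cmap (M : chartedSpace R) (aM : smooth_atlas M) c (x : M) :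
  atlas M c -> cdom c x -> @smooth_at R M (euclid (mdim M)) (cmap c) x.
Proof.
move=> Mc cx; have [chM _ _] := aM.
apply: (germ_smooth_at aM (euclid_atlas _) (c := c) (d := Chart setT id id)) => //.
  exact: (cmap_continuous (chM _ Mc)).
apply: germ_ext (germ_id _).
have := near_cimg (chM _ Mc) (cimg_cmap cx).
by apply: filterS => y cy; rewrite /in_charts/= (cinvK (chM _ Mc)).
Qed.

Lemma smooth_at_cinv (M : chartedSpace R) (aM : smooth_atlas M) c y :
  atlas M c -> cimg c y -> @smooth_at R (euclid (mdim M)) M (cinv c) y.
Proof.
move=> Mc cy; have [chM _ _] := aM.
apply: (germ_smooth_at (euclid_atlas _) aM (c := Chart setT id id) (d := c)) => //.
- exact: (cinv_continuous (chM _ Mc)).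
- exact: (cdom_cinv (chM _ Mc)).
- apply: germ_ext (germ_id _); have := near_cimg (chM _ Mc) cy.
  by apply: filterS => z cz; rewrite /in_charts/= (cinvK (chM _ Mc)).
Qed.

End Euclid.

Section Products.
Context (R : realType).

Lemma cvg_row_mx (T : Type) (F : set_system T) (FF : Filter F) m1 m2
    (f : T -> 'rV[R]_m1) (g : T -> 'rV[R]_m2) (a : 'rV[R]_m1) (b : 'rV[R]_m2) :
  f x @[x --> F] --> a -> g x @[x --> F] --> b ->
  row_mx (f x) (g x) @[x --> F] --> row_mx a b.
Proof.
move=> fa gb; apply: cvg_row => i.
have coord m (h : T -> 'rV[R]_m) (l : 'rV[R]_m) j : h x @[x --> F] --> l ->
    h x ord0 j @[x --> F] --> l ord0 j.
  by move=> hl; apply: (cvg_comp h (fun y : 'rV[R]_m => y ord0 j) hl); exact: coord_continuous.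
case: (splitP i) => j ij.
  have -> : i = lshift m2 j by exact: val_inj.
  under eq_cvg do rewrite row_mxEl; rewrite row_mxEl; exact: coord.
have -> : i = rshift m1 j by exact: val_inj.
under eq_cvg do rewrite row_mxEr; rewrite row_mxEr; exact: coord.
Qed.

Section ProdChart.
Context (M N : topologicalType) (m n : nat) (c : chart R M m) (d : chart R N n).

Lemma prod_chart_is_chart : is_chart c -> is_chart d -> is_chart (prod_chart c d).
Proof.
move=> hc hd; have Eimg : cimg (prod_chart c d) =
    setT `&` (fun v => (lsubmx v, rsubmx v)) @^-1` (cimg c `*` cimg d).
  rewrite setTI; apply/seteqP; split=> [_ [[x y] [/= cx dy] <-]|v [/= [x cx xv] [y dy yv]]].
    by split=> /=; rewrite ?row_mxKl ?row_mxKr; exact: cimg_cmap.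
  by exists (x, y); rewrite //= xv yv hsubmxK.
have sub_cont (v : 'rV[R]_(m + n)) :
    {for v, continuous (fun v : 'rV[R]_(m + n) => (lsubmx v, rsubmx v))}.
  apply: continuous_pair.
    exact: (germ_continuous (germ_lsubmx v)).
  exact: (germ_continuous (germ_rsubmx v)).
have [oc oci _ _ _] := hc; have [od odi _ _ _] := hd.
have oX (S T : topologicalType) (A : set S) (B : set T) : open A -> open B ->
    open (A `*` B).
  move=> oA oB; rewrite openE => -[x y] [/= Ax By].
  by exists (A, B) => //; split; exact: open_nbhs_nbhs.
split.
- exact: oX.
- rewrite Eimg; apply: open_setI_preimage; [exact: openT|exact: oX|].
  by move=> v _; exact: sub_cont.
- by move=> [x y] [/= cx dy]; rewrite row_mxKl row_mxKr !chartK.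
- move=> [x y] [/= cx dy]; apply: cvg_row_mx.
    apply: (@continuous_comp _ _ _ fst (cmap c)); first exact: cvg_fst.
    exact: cmap_continuous.
  apply: (@continuous_comp _ _ _ snd (cmap d)); first exact: cvg_snd.
  exact: cmap_continuous.
- move=> v; rewrite Eimg => -[_ [/= cv dv]]; apply: continuous_pair.
    apply: (@continuous_comp _ _ _ (@lsubmx R 1 m n) (cinv c)).
      exact: (germ_continuous (germ_lsubmx v)).
    exact: cinv_continuous.
  apply: (@continuous_comp _ _ _ (@rsubmx R 1 m n) (cinv d)).
    exact: (germ_continuous (germ_rsubmx v)).
  exact: cinv_continuous.
Qed.

End ProdChart.

Lemma prod_atlas (M N : chartedSpace R) : smooth_atlas M -> smooth_atlas N ->
  smooth_atlas (prod_space M N).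
Proof.
move=> aM aN; have [chM coM _] := aM; have [chN coN _] := aN; split.
- move=> _ [c [d [Mc Nd ->]]].
  by apply: prod_chart_is_chart; [exact: chM|exact: chN].
- move=> [x y]; have [c Mc cx] := coM x; have [d Nd dy] := coN y.
  by exists (prod_chart c d) => //; exists c, d.
- move=> _ _ [c [d [Mc Nd ->]]] [c' [d' [Mc' Nd' ->]]].
  apply: Cinfty_germ => _ [[x y] [[/= cx dy] [/= c'x d'y]] <-].
  apply: germ_row_mx.
    apply: (@germ_comp _ _ _ _ (@lsubmx R 1 _ _) (cmap c' \o cinv c)).
      exact: germ_lsubmx.
    by rewrite row_mxKl; exact: (transition_germ aM).
  apply: (@germ_comp _ _ _ _ (@rsubmx R 1 _ _) (cmap d' \o cinv d)).
    exact: germ_rsubmx.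
  by rewrite row_mxKr; exact: (transition_germ aN).
Qed.

Lemma smooth_at_pair (L M N : chartedSpace R) (f : L -> M) (g : L -> N) x :
  smooth_atlas L -> smooth_atlas M -> smooth_atlas N ->
  smooth_at f x -> smooth_at g x ->
  @smooth_at R L (prod_space M N) (fun z => (f z, g z)) x.
Proof.
move=> aL aM aN sf sg; have [chL coL _] := aL.
have [chM coM _] := aM; have [chN coN _] := aN.
have [b Lb bx] := coL x; have [c Mc cx] := coM (f x); have [d Nd dx] := coN (g x).
apply: (@germ_smooth_at _ _ _ aL (prod_atlas aM aN) _ _ b (prod_chart c d)) => //.
- by apply: continuous_pair; exact: smooth_at_continuous.
- by exists c, d.
- apply: (@germ_row_mx _ _ _ _ (in_charts f b c) (in_charts g b d)).
    exact: smooth_at_germ.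
  exact: smooth_at_germ.
Qed.

(** Membership in a fibre product is an equation between smooth maps, so
    this lemma is how partially defined smooth operations are used: their
    composition with smooth maps satisfying the equation is smooth in the plain
    sense. *)
Lemma smooth_on_comp (L M N : chartedSpace R) (S : set M) (f : M -> N) (k : L -> M) x :
  smooth_atlas L -> smooth_atlas M -> smooth_atlas N ->
  smooth_on S f -> smooth_at k x -> (\near x, S (k x)) ->
  smooth_at (f \o k) x.
Proof.
move=> aL aM aN sf sk Sk.
have [U [F [Ukx sF FE]]] := sf _ (nbhs_singleton Sk).
have sFk : smooth_at F (k x) by exists U.
have [oU _ _] := sF.
apply: (smooth_at_ext aL aN) (smooth_at_comp aL aM aN sk sFk).
have Uk : \near x, U (k x).
  exact: (smooth_at_continuous sk (open_nbhs_nbhs (conj oU Ukx))).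
by apply: filterS2 Sk Uk => y; exact: FE.
Qed.

End Products.

(** * Jacobian matrices *)

Section JacobianCalculus.
Context (R : realType).

Lemma mulmx_row_inj n m (A B : 'M[R]_(n, m)) :
  (forall v : 'rV[R]_n, v *m A = v *m B) -> A = B.
Proof. by move=> AB; apply/row_matrixP => i; rewrite !rowE. Qed.

Lemma jacobian_eq n m (f : 'rV[R]_n -> 'rV[R]_m) x A :
  (forall v, 'd f x v = v *m A) -> jacobian f x = A.
Proof.
move=> fA; apply: mulmx_row_inj => v.
exact: etrans (esym (diff_jacobian f x v)) (fA v).
Qed.

Lemma near_eq_jacobian n m (f g : 'rV[R]_n -> 'rV[R]_m) x :
  (\near x, f x = g x) -> differentiable f x -> jacobian f x = jacobian g x.
Proof.
move=> fg df; apply: jacobian_eq => v.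
exact: etrans (congr1 (fun h => h v) (near_eq_diff fg df)) (diff_jacobian g x v).
Qed.

Lemma jacobianD n m (f g : 'rV[R]_n -> 'rV[R]_m) x :
  differentiable f x -> differentiable g x ->
  jacobian (fun x => f x + g x) x = jacobian f x + jacobian g x.
Proof.
move=> df dg; apply: jacobian_eq => v; rewrite mulmxDr.
apply: etrans (congr1 (fun h => h v) (diffD df dg)) _.
exact: (congr2 +%R (diff_jacobian f x v) (diff_jacobian g x v)).
Qed.

Lemma jacobian_mulmxr n m l (f : 'rV[R]_n -> 'rV[R]_m) (A : 'M[R]_(m, l)) x :
  differentiable f x -> jacobian (fun x => f x *m A) x = jacobian f x *m A.
Proof.
move=> df; have dA : differentiable (fun y : 'rV[R]_m => y *m A) (f x).
  by have [] := mulmx_diff A (f x).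
by rewrite (jacobian_comp df dA) jacobian_mulmx.
Qed.

Lemma jacobian_id n x : jacobian (@id 'rV[R]_n) x = 1%:M.
Proof.
rewrite -[RHS](jacobian_mulmx 1%:M x); congr (jacobian _ _).
by apply/funext => y; rewrite mulmx1.
Qed.

Lemma jacobian_cst n m (a : 'rV[R]_m) (x : 'rV[R]_n) : jacobian (cst a) x = 0.
Proof.
apply: jacobian_eq => v; rewrite mulmx0.
exact: (congr1 (fun h => h v) (diff_cst _ _)).
Qed.

Lemma jacobian_row_mx n m1 m2 (f : 'rV[R]_n -> 'rV[R]_m1) (g : 'rV[R]_n -> 'rV[R]_m2) x :
  differentiable f x -> differentiable g x ->
  jacobian (fun x => row_mx (f x) (g x)) x = row_mx (jacobian f x) (jacobian g x).
Proof.
move=> df dg.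
have E l (A : 'M[R]_(l, m1)) (B : 'M[R]_(l, m2)) :
    row_mx A B = A *m row_mx 1%:M 0 + B *m row_mx 0 1%:M.
  by rewrite !mul_mx_row !mulmx1 !mulmx0 add_row_mx addr0 add0r.
rewrite (_ : (fun x => _) = (fun x => f x *m row_mx 1%:M 0 + g x *m row_mx 0 1%:M)).
  have dM l (h : 'rV[R]_n -> 'rV[R]_l) (A : 'M[R]_(l, m1 + m2)) :
      differentiable h x -> differentiable (fun x => h x *m A) x.
    move=> dh; apply: (@differentiable_comp _ _ _ _ h (fun y => y *m A)) => //.
    by have [] := mulmx_diff A (h x).
  rewrite jacobianD; [|exact: dM|exact: dM].
  by rewrite !jacobian_mulmxr// -E.
by apply/funext => y; exact: E.
Qed.

Lemma full_jacobianP n m (f : 'rV[R]_n -> 'rV[R]_m) x :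
  set_surj setT setT ('d f x) <-> row_full (jacobian f x).
Proof.
split=> [sf|Jf].
  rewrite -sub1mx; apply/row_subP => i.
  have [v _ <-] := sf (row i 1%:M) I.
  by rewrite diff_jacobian submxMl.
move=> w _; exists (w *m pinvmx (jacobian f x)) => //.
by rewrite diff_jacobian -mulmxA mulVpmx// mulmx1.
Qed.

(** The matrices [row_mx J L] and [col_mx E K] are inverse to each other: the
    space is the direct sum of the image of [E] and of the kernel of [J], which
    has [K] as a basis. *)
Lemma kernel_complement m d (E : 'M[R]_(d, m)) (J : 'M[R]_(m, d)) :
  E *m J = 1%:M -> exists (K : 'M[R]_(m - d, m)) (L : 'M[R]_(m, m - d)),
  [/\ K *m J = 0, K *m L = 1%:M, E *m L = 0 & J *m E + L *m K = 1%:M].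
Proof.
move=> EJ; have rJ : \rank J = d.
  by apply/eqP; rewrite -/(row_full J) -sub1mx -EJ submxMl.
have [K fK eK] : exists2 K : 'M[R]_(m - d, m), row_free K & (K :=: kermx J)%MS.
  have e : \rank (kermx J) = (m - d)%N by rewrite mxrank_ker rJ.
  rewrite -e; exists (row_base (kermx J)); first exact: row_base_free.
  exact: eq_row_base.
have KJ : K *m J = 0 by apply/sub_kermxP; rewrite eK.
exists K, ((1%:M - J *m E) *m pinvmx K); split=> //.
- by rewrite mulmxA mulmxBr mulmx1 (mulmxA K J E) KJ mul0mx subr0 mulmxVp.
- by rewrite mulmxA mulmxBr mulmx1 (mulmxA E J E) EJ mul1mx subrr mul0mx.
- rewrite mulmxKpV; first by rewrite addrC subrK.
  rewrite eK; apply/sub_kermxP.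
  by rewrite mulmxBl mul1mx -mulmxA EJ mulmx1 subrr.
Qed.

End JacobianCalculus.

(** * Submersions *)

Section Submersions.
Context (R : realType).

(** The chain rule, in a form that lets the rank be computed after composition with
    any smooth [t] through the point. *)
Lemma surjective_differential (M N : chartedSpace R) (f : M -> N) x j
    (t : euclid R j -> M) (v : euclid R j) c d :
  smooth_atlas M -> smooth_atlas N -> smooth_at f x -> smooth_at t v -> t v = x ->
  atlas M c -> atlas N d -> cdom c x -> cdom d (f x) ->
  row_full (jacobian (cmap d \o f \o t : 'rV[R]_j -> _) v) ->
  set_surj setT setT ('d (in_charts f c d) (cmap c x)).
Proof.
move=> aM aN sf st tv Mc Nd cx dx full; apply/full_jacobianP.
have [chM _ _] := aM; have ae := @euclid_atlas R.
have gct : germ (cmap c \o t : 'rV[R]_j -> _) v.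
  apply/smooth_at_euclid; apply: (smooth_at_comp (ae j) aM (ae _)) => //.
  by rewrite tv; exact: smooth_at_cmap.
have gf := smooth_at_germ aM aN sf Mc Nd cx dx.
have dct := germ_differentiable gct.
have df : differentiable (in_charts f c d) ((cmap c \o t) v).
  by rewrite /= tv; exact: germ_differentiable.
have E : \forall w \near (v : 'rV[R]_j),
    (in_charts f c d \o (cmap c \o t)) w = (cmap d \o f \o t) w.
  have : \forall w \near v, cdom c (t w).
    by apply: (smooth_at_continuous st); rewrite tv; exact: near_cdom (chM _ Mc) _ _.
  by apply: filterS => w cw; rewrite /in_charts/= (chartK (chM _ Mc)).
move: full; rewrite -(near_eq_jacobian E (differentiable_comp dct df)).
rewrite (jacobian_comp dct df) /= tv -!sub1mx => /submx_trans; apply.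
exact: submxMl.
Qed.

(** A right inverse [E] of the jacobian spans an affine subspace through [y] on which
    [q] is a local diffeomorphism; the section is its inverse. *)
Lemma submersion_section (Y D : chartedSpace R) (q : Y -> D) y :
  smooth_atlas Y -> smooth_atlas D -> submersion q ->
  exists s : D -> Y, [/\ smooth_at s (q y), s (q y) = y &
    \forall z \near q y, q (s z) = z].
Proof.
move=> aY aD [sq surj]; have [chY coY _] := aY; have [chD coD _] := aD.
have ae := @euclid_atlas R.
have [c Yc cy] := coY y; have [d Dd dy] := coD (q y).
have [hc hd] := (chY _ Yc, chD _ Dd).
set F := in_charts q c d; set u0 := cmap c y.
have gF : germ F u0 by exact: (smooth_at_germ aY aD (smooth_smooth_at _ sq)).
have /full_jacobianP fullJ := surj c d y Yc Dd cy dy.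
set J := jacobian F u0 in fullJ; pose E := pinvmx J.
have EJ : E *m J = 1%:M by exact: mulVpmx.
pose s0 := cmap d (q y).
have Fu0 : F u0 = s0 by rewrite /F /u0 /in_charts/= chartK.
pose l (s : 'rV[R]_(mdim D)) := s *m E + (u0 - s0 *m E).
have ls0 : l s0 = u0 by rewrite /l addrC subrK.
have gl s : germ l s by apply: germD; [exact: germ_mulmx|exact: germ_cst].
have gFl : germ (F \o l) s0 by apply: germ_comp => //; rewrite ls0.
have J1 : jacobian (F \o l) s0 = 1%:M.
  rewrite jacobian_comp; [|exact/germ_differentiable/gl|].
    rewrite ls0 -/J -[RHS]EJ; congr (_ *m _).
    rewrite /l jacobianD; [|exact/germ_differentiable/germ_mulmx|exact: differentiable_cst].
    by rewrite jacobian_mulmx jacobian_cst addr0.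
  by rewrite ls0; exact: germ_differentiable.
have [||h [gh hs0 _ Fh]] := germ_inverse gFl (B := 1%:M).
- by rewrite J1 mulmx1.
- by rewrite J1 mulmx1.
have FlE : (F \o l) s0 = s0 by rewrite /= ls0.
rewrite FlE in gh hs0 Fh.
pose t : euclid R (mdim D) -> Y := cinv c \o (l \o h).
have ts0 : t s0 = y by rewrite /t/= hs0 ls0 chartK.
have st : smooth_at t s0.
  apply: (smooth_at_comp (ae _) (ae _) aY); last first.
    apply: (smooth_at_cinv aY) => //=.
    by rewrite hs0 ls0; exact: cimg_cmap.
  by apply/smooth_at_euclid; apply: germ_comp.
exists (t \o cmap d); split.
- apply: (smooth_at_comp aD (ae _) aY); first exact: smooth_at_cmap.
  exact: st.
- exact: ts0.
- have st' : smooth_at (t \o cmap d) (q y).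
    by apply: (smooth_at_comp aD (ae _) aY) => //; exact: smooth_at_cmap.
  have sqt : smooth_at (q \o (t \o cmap d)) (q y).
    by apply: (smooth_at_comp aD aY aD) => //; exact: smooth_smooth_at.
  have qt : \forall z \near q y, cdom d (q (t (cmap d z))).
    apply: (smooth_at_continuous sqt); rewrite /= ts0.
    exact: near_cdom.
  have Fd : \forall z \near q y, F (l (h (cmap d z))) = cmap d z.
    exact: (cmap_continuous hd dy Fh).
  have dd := near_cdom hd dy.
  apply: filterS3 qt Fd dd => z z1 z2 z3.
  rewrite -[LHS](chartK hd z1) -[RHS](chartK hd z3).
  exact: (congr1 (cinv d) z2).
Qed.

End Submersions.

(** * Coordinates on a family of groups *)

Section GroupCoordinates.
Context (R : realType) (D G : chartedSpace R) (GF : group_family D G).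

Let ae := @euclid_atlas R.

Lemma group_family_atlas : smooth_atlas G /\ smooth_atlas D.
Proof.
by have [mG mD _] := gproj_family GF; split; exact: smooth_manifold_atlas.
Qed.

Local Notation q := (mdim G - mdim D)%N.

(** Near the identity section the group family is a product of the base and of a
    space of coordinates [lam] along the fibres, in which the identity section is
    the origin. The coordinate is the deviation of [g] from the identity element
    of its fibre, projected by [L] to the tangent space of the fibre. *)
Lemma group_coordinates (z0 : D) :
  exists (Phi : prod_space D (euclid R q) -> G) (lam : G -> euclid R q),
  [/\ smooth_at Phi ((z0, 0 : 'rV[R]_q) : prod_space D (euclid R q)), smooth_at lam (gone GF z0),
      \forall z \near ((z0, 0 : 'rV[R]_q) : prod_space D (euclid R q)),
        gproj GF (Phi z) = z.1 /\ lam (Phi z) = z.2,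
      \forall g \near gone GF z0, Phi (gproj GF g, lam g) = g &
      \forall z \near z0, lam (gone GF z) = 0].
Proof.
have [aG aD] := group_family_atlas; have [chG coG _] := aG; have [chD coD _] := aD.
have [_ _ [sp _]] := gproj_family GF; have so := gone_smooth GF.
set e0 := gone GF z0; have pe0 : gproj GF e0 = z0 by exact: goneP.
have [c Gc ce0] := coG e0; have [b Db bz0] := coD z0.
have [hc hb] := (chG _ Gc, chD _ Db).
have bpe0 : cdom b (gproj GF e0) by rewrite pe0.
set P := in_charts (gproj GF) c b; set Eg := in_charts (gone GF) b c.
pose w0 := cmap c e0; pose s0 := cmap b z0.
have gP : germ P w0 by exact: (smooth_at_germ aG aD (smooth_smooth_at _ sp)).
have gE : germ Eg s0 by exact: (smooth_at_germ aD aG (smooth_smooth_at _ so)).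
have Pw0 : P w0 = s0 by rewrite /P /w0 /in_charts/= chartK// pe0.
have Es0 : Eg s0 = w0 by rewrite /Eg /s0 /in_charts/= chartK.
have gE' : germ Eg (P w0) by rewrite Pw0.
have gP' : germ P (Eg s0) by rewrite Es0.
have dP := germ_differentiable gP; have dE := germ_differentiable gE.
pose J := jacobian P w0; pose E := jacobian Eg s0.
have oc0 : \forall z \near z0, cdom c (gone GF z).
  exact: (smooth_at_continuous (smooth_smooth_at _ so) (near_cdom hc ce0)).
have EJ : E *m J = 1%:M.
  rewrite /E /J -Es0 -jacobian_comp//; last by rewrite Es0.
  rewrite -(jacobian_id s0); apply: near_eq_jacobian; last first.
    exact/germ_differentiable/germ_comp.
  have := near_cimg hb (cimg_cmap bz0); have := near_cinv hb bz0 oc0.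
  apply: filterS2 => s cs bs.
  by rewrite /P /Eg /in_charts/= (chartK hc)// goneP (cinvK hb).
have [K [L [KJ KL EL JELK]]] := kernel_complement EJ.
pose lam0 (w : 'rV[R]_(mdim G)) := (w - Eg (P w)) *m L.
have lam0E : lam0 = (fun w => w *m L + Eg (P w) *m (- L)).
  by apply/funext => w; rewrite /lam0 mulmxBl mulmxN.
have glam0 : germ lam0 w0.
  rewrite lam0E; apply: germD; first exact: germ_mulmx.
  apply: (@germ_comp _ _ _ _ (Eg \o P) (fun y => y *m - L)); last exact: germ_mulmx.
  exact: germ_comp.
pose Psi (w : 'rV[R]_(mdim G)) := row_mx (P w) (lam0 w).
have gPsi : germ Psi w0 by exact: germ_row_mx.
have Psiw0 : Psi w0 = row_mx s0 0.
  by rewrite /Psi /lam0 Pw0 Es0 subrr mul0mx.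
have JPsi : jacobian Psi w0 = row_mx J L.
  rewrite jacobian_row_mx//; last exact: germ_differentiable.
  congr row_mx; rewrite lam0E jacobianD.
  - rewrite jacobian_mulmx.
    rewrite (@jacobian_mulmxr _ _ _ _ (Eg \o P)); last exact/germ_differentiable/germ_comp.
    rewrite jacobian_comp//; last exact: germ_differentiable.
    by rewrite Pw0 -/E -mulmxA mulmxN EL oppr0 mulmx0 addr0.
  - exact/germ_differentiable/germ_mulmx.
  - apply/germ_differentiable.
    apply: (@germ_comp _ _ _ _ (Eg \o P) (fun y => y *m - L)); last exact: germ_mulmx.
    exact: germ_comp.
have [||h [gh hw0 hPsi Psih]] := germ_inverse gPsi (B := col_mx E K).
- by rewrite JPsi mul_row_col.
- rewrite JPsi mul_col_row EJ EL KJ KL -scalar_mx_block//.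
rewrite Psiw0 in gh hw0 Psih.
pose rm (z : prod_space D (euclid R q)) : euclid R (mdim D + q) :=
  row_mx (cmap b z.1) z.2.
have srm : smooth_at rm ((z0, 0 : 'rV[R]_q) : prod_space D (euclid R q)).
  pose bb : chart R (euclid R q) q := Chart setT id id.
  exact: (@smooth_at_cmap R _ (prod_atlas aD (ae q)) (prod_chart b bb) (z0, 0)
    (ex_intro _ b (ex_intro _ bb (And3 Db (erefl _) (erefl _)))) (conj bz0 I)).
pose Phi : prod_space D (euclid R q) -> G := cinv c \o h \o rm.
pose lam : G -> euclid R q := lam0 \o cmap c.
have aDq := prod_atlas aD (ae q).
have sh : @smooth_at R (euclid R _) G (cinv c \o h) (row_mx s0 0).
  apply: (smooth_at_comp (ae _) (ae _) aG); last first.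
    by apply: (smooth_at_cinv aG) => //; rewrite /= hw0; exact: cimg_cmap.
  exact/smooth_at_euclid.
have sPhi : smooth_at Phi ((z0, 0 : 'rV[R]_q) : prod_space D (euclid R q)).
  exact: (smooth_at_comp aDq (ae _) aG srm sh).
have Phi0 : Phi (z0, 0) = e0 by rewrite /Phi/= -/s0 hw0 chartK.
exists Phi, lam; split=> //.
- apply: (smooth_at_comp aG (ae _) (ae _)); first exact: smooth_at_cmap.
  exact/smooth_at_euclid.
- have rmc := smooth_at_continuous srm.
  have n1 := near_continuous rmc Psih.
  have n2 : \forall z \near ((z0, 0 : 'rV[R]_q) : prod_space D (euclid R q)), cimg c (h (rm z)).
    apply: (near_continuous (P := [set y | cimg c (h y)]) rmc).
    apply: (near_continuous (germ_continuous gh)); rewrite hw0.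
    exact: (near_cimg hc (cimg_cmap ce0)).
  have n3 : \forall z \near ((z0, 0 : 'rV[R]_q) : prod_space D (euclid R q)), cdom b (gproj GF (Phi z)).
    have := smooth_at_comp aDq aG aD sPhi (smooth_smooth_at _ sp).
    move=> /smooth_at_continuous/near_continuous; apply.
    by rewrite /= Phi0 pe0; exact: near_cdom.
  have n4 : \forall z \near ((z0, 0 : 'rV[R]_q) : prod_space D (euclid R q)), cdom b z.1.
    have := near_cdom hb bz0; exact: (@cvg_fst _ _ (nbhs z0) (nbhs (0 : 'rV[R]_q))).
  have FF := @nbhs_filter (prod_space D (euclid R q)) (z0, 0 : 'rV[R]_q).
  have n12 := @filterI _ _ FF _ _ n1 n2; have n34 := @filterI _ _ FF _ _ n3 n4.
  apply: (@filterS2 _ _ FF _ _ _ _ n12 n34) => z [+ z2] [z3 z4].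
  rewrite /= /Psi /rm => /eq_row_mx[z5 z6]; split.
    rewrite -[LHS](chartK hb z3) -[RHS](chartK hb z4).
    exact: (congr1 (cinv b) z5).
  by rewrite /lam /Phi/= (cinvK hc z2).
- have n1 : \forall g \near e0, h (Psi (cmap c g)) = cmap c g.
    exact: (cmap_continuous hc ce0 hPsi).
  have n2 := near_cdom hc ce0.
  apply: filterS2 n1 n2 => g g1 g2.
  rewrite /Phi /lam /rm/=; have -> : cmap b (gproj GF g) = P (cmap c g).
    by rewrite /P /in_charts/= (chartK hc).
  by rewrite -/(Psi _) g1 (chartK hc).
- apply: filterS2 oc0 (near_cdom hb bz0) => z cz bz.
  rewrite /lam /lam0/= /P /Eg /in_charts/= (chartK hc)// goneP (chartK hb)//.
  by rewrite subrr mul0mx.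
Qed.

End GroupCoordinates.

(** * Maps of locally constant rank *)

Section ConstantRank.
Context (R : realType).

(** By the mean value theorem, applied to every component. *)
Lemma zero_jacobian_constant n m (g : 'rV[R]_n -> 'rV[R]_m) x :
  (\forall y \near x, differentiable g y /\ jacobian g y = 0) ->
  \forall y \near x, g y = g x.
Proof.
move=> /nbhs_ballP[r r0 H]; apply/nbhs_ballP; exists r => // y By.
have Bx : ball x r x by exact: ballxx.
apply/rowP => i; pose phi z : R^o := g z ord0 i.
have phiE : phi = (fun z : 'rV[R]_m => z ord0 i : R^o) \o g by [].
have dphi z : differentiable g z -> differentiable phi z.
  exact: differentiable_row_coord.
have [|t t01 E] := @mean_value R n phi y x.
  by move=> t t01; have [/dphi] := H _ (ball_segment t01 By Bx).
have [dg Jg] := H _ (ball_segment t01 By Bx).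
apply/eqP; rewrite -subr_eq0 -[X in X == _]/(phi y - phi x) E -deriveE; last exact: dphi.
by rewrite -derive_coord// deriveE// diff_jacobian Jg mulmx0 mxE.
Qed.

(** The rank cannot drop near [v0] either, so the fibre of [f] through [v0] is a
    manifold of the dimension of the kernel of the derivative, which is 0 if
    [v0] is isolated in its fibre. In detail, complete a maximal set [N] of
    independent combinations of the components of [f] by linear forms [L] to
    local coordinates [Psi]. On the submanifold [c] where only [L] varies, the
    derivative of [f] has image in the kernel of [N]; by the bound on the rank,
    that kernel meets the image of the derivative of [f] trivially. So [f] is
    constant on [c], which therefore reduces to [v0]. *)
Lemma isolated_fibre_immersion q n (f : 'rV[R]_q -> 'rV[R]_n) (v0 : 'rV[R]_q) :
  germ f v0 ->
  (\forall v \near v0, (\rank (jacobian f v) <= \rank (jacobian f v0))%N) ->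
  (\forall v \near v0, f v = f v0 -> v = v0) ->
  row_free (jacobian f v0).
Proof.
move=> gf rk inj; set T := jacobian f v0; set r := \rank T.
pose N := pinvmx (row_base T); pose C := T *m N.
have CE : C = col_base T.
  by rewrite /C -[X in X *m N](mulmx_base T) -mulmxA mulmxVp ?row_base_free// mulmx1.
have fullC : row_full C by rewrite CE col_base_full.
pose E := pinvmx C; have EC : E *m C = 1%:M by exact: mulVpmx.
have [K [L [KC KL EL CELK]]] := kernel_complement EC.
pose Psi (v : 'rV[R]_q) := row_mx (f v *m N) (v *m L).
have gfN v : germ f v -> germ (fun v => f v *m N) v.
  move=> gfv; apply: (@germ_comp _ _ _ _ f (fun y => y *m N)) => //.
  exact: germ_mulmx.
have gPsi v : germ f v -> germ Psi v.
  by move=> gfv; apply: germ_row_mx; [exact: gfN|exact: germ_mulmx].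
have JPsi v : germ f v -> jacobian Psi v = row_mx (jacobian f v *m N) L.
  move=> gfv; rewrite jacobian_row_mx.
  - by rewrite jacobian_mulmx jacobian_mulmxr//; exact: germ_differentiable.
  - exact/germ_differentiable/gfN.
  - exact/germ_differentiable/germ_mulmx.
have JPsi0 : jacobian Psi v0 = row_mx C L by rewrite JPsi.
have [||h [gh hv0 _ Psih]] := germ_inverse (gPsi _ gf) (B := col_mx E K).
- by rewrite JPsi0 mul_row_col.
- by rewrite JPsi0 mul_col_row EC EL KC KL -scalar_mx_block.
pose l (s : 'rV[R]_(q - r)) : 'rV[R]_(r + (q - r)) := s *m row_mx 0 1%:M + Psi v0.
have l0 : l 0 = Psi v0 by rewrite /l mul0mx add0r.
have gl s : germ l s by apply: germD; [exact: germ_mulmx|exact: germ_cst].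
have lE s : l s = row_mx (f v0 *m N) (s + v0 *m L).
  by rewrite /l mul_mx_row mulmx0 mulmx1 add_row_mx add0r.
pose c := h \o l.
have c0 : c 0 = v0 by rewrite /c/= l0.
have gc : germ c 0 by apply: germ_comp; [exact: gl|rewrite l0].
have near_l (P : set _) : (\forall y \near Psi v0, P y) ->
    \forall s \near (0 : 'rV[R]_(q - r)), P (l s).
  by move=> HP; apply: (near_continuous (germ_continuous (gl 0))); rewrite l0.
have near_c (P : set _) : (\forall y \near v0, P y) ->
    \forall s \near (0 : 'rV[R]_(q - r)), P (c s).
  by move=> HP; apply: (near_continuous (germ_continuous gc)); rewrite c0.
have J0 : \forall s \near (0 : 'rV[R]_(q - r)),
    differentiable (f \o c) s /\ jacobian (f \o c) s = 0.
  have n1 := near_c _ (germ_near gf); have n2 := near_c _ rk.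
  have n3 := near_l _ (nbhs_interior Psih); have n4 := near_l _ (germ_near gh).
  near=> s.
  have gfc : germ f (c s) by near: s; exact: n1.
  have rkc : (\rank (jacobian f (c s)) <= r)%N by near: s; exact: n2.
  have Psil : \forall y \near l s, Psi (h y) = y by near: s; exact: n3.
  have ghs : germ h (l s) by near: s; exact: n4.
  have gcs : germ c s by exact: germ_comp.
  have dc := germ_differentiable gcs; have df := germ_differentiable gfc.
  split; first exact: differentiable_comp.
  rewrite (jacobian_comp dc df); set A := jacobian f (c s).
  have dh := germ_differentiable ghs.
  have dPsi := germ_differentiable (gPsi _ gfc).
  have hJ : jacobian h (l s) *m row_mx (A *m N) L = 1%:M.
    rewrite -(JPsi _ gfc) -(jacobian_comp dh dPsi) -[RHS](jacobian_id (l s)).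
    by apply: near_eq_jacobian => //; exact: differentiable_comp.
  have fullAN : row_full (A *m N).
    have H : usubmx (jacobian h (l s)) *m (A *m N) = 1%:M.
      have := congr1 (fun B => ulsubmx B) hJ.
      rewrite -[X in X *m _]vsubmxK mul_col_row block_mxKul => ->.
      by rewrite scalar_mx_block block_mxKul.
    by rewrite -sub1mx -H submxMl.
  have rAN : \rank (A *m N) = r by apply/eqP.
  have AN0 : (A :&: kermx N)%MS = 0.
    apply/eqP; rewrite -mxrank_eq0; have := mxrank_mul_ker A N.
    by move: rkc; rewrite -/A rAN; lia.
  have cAN : jacobian c s *m A *m N = 0.
    have dN := germ_differentiable (gfN _ gfc).
    rewrite -mulmxA -(@jacobian_mulmxr _ _ _ _ f N) // -(jacobian_comp dc dN).
    rewrite -[RHS](@jacobian_cst R _ _ (f v0 *m N) s); apply: near_eq_jacobian.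
      have := near_continuous (germ_continuous (gl s)) Psil.
      by apply: filterS => s' /=; rewrite {2}lE /Psi => /eq_row_mx[].
    exact: differentiable_comp.
  apply/eqP; rewrite -submx0 -AN0 sub_capmx submxMl.
  by apply/sub_kermxP.
have Z := zero_jacobian_constant J0.
have S0 : \forall s \near (0 : 'rV[R]_(q - r)), s = 0.
  apply: filterS3 Z (near_c _ inj) (near_l _ Psih) => s /=.
  rewrite c0 => fcs /(_ fcs) cs; rewrite [h _]cs lE /Psi => /eq_row_mx[_].
  by rewrite -[X in X = _]add0r => /addIr <-.
suff qr : (q <= r)%N by rewrite /row_free eqn_leq rank_leq_row.
rewrite leqNgt; apply/negP => rq.
have i : 'I_(q - r) by exists 0; rewrite subn_gt0.
move/nbhs_ballP : S0 => [e e0 /(_ (e / 2 *: delta_mx ord0 i))].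
have n1 : `|delta_mx ord0 i : 'rV[R]_(q - r)| <= 1.
  by apply: norm_row_le => // j; rewrite !mxE; case: (_ && _); rewrite ?normr1 ?normr0.
have e20 : 0 < e / 2 by rewrite divr_gt0.
rewrite -ball_normE /ball_/= sub0r normrN normrZ gtr0_norm// => H.
have : e / 2 *: delta_mx ord0 i = 0 :> 'rV[R]_(q - r).
  apply: H; have : e / 2 * `|delta_mx ord0 i : 'rV[R]_(q - r)| <= e / 2 * 1.
    by rewrite ler_pM2l.
  lra.
move/matrixP/(_ ord0 i); rewrite !mxE !eqxx mulr1 => /eqP.
by rewrite gt_eqF.
Unshelve. all: by end_near. Qed.

End ConstantRank.

(** * Orbits of a free action are immersed *)

Section Actions.
Context (R : realType) (D G X : chartedSpace R) (GF : group_family D G)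
  (p : X -> D) (Xfam : smooth_family p) (a : family_action GF p).

Local Notation E := (euclid R).
Local Notation q := (mdim G - mdim D)%N.
Local Notation pg := (gproj GF).
Local Notation e := (gone GF).

Let aG : smooth_atlas G. Proof. by have [] := group_family_atlas GF. Qed.
Let aD : smooth_atlas D. Proof. by have [] := group_family_atlas GF. Qed.
Let aX : smooth_atlas X.
Proof. by have [mX _ _] := Xfam; exact: smooth_manifold_atlas. Qed.
Let aE n : smooth_atlas (E n). Proof. exact: euclid_atlas. Qed.

Lemma family_smooth_at x : smooth_at p x.
Proof. by have [_ _ [sp _]] := Xfam; exact: smooth_smooth_at. Qed.

Lemma act_smooth_at (L : chartedSpace R) (k : L -> G) (f : L -> X) l :
  smooth_atlas L -> smooth_at k l -> smooth_at f l ->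
  (\forall l' \near l, pg (k l') = p (f l')) ->
  smooth_at (fun l => act a (k l) (f l)) l.
Proof.
move=> aL sk sf kf.
exact: (smooth_on_comp aL (prod_atlas aG aX) aX (act_smooth a)
  (smooth_at_pair aL aG aX sk sf) kf).
Qed.

Lemma gmul_smooth_at (L : chartedSpace R) (k h : L -> G) l :
  smooth_atlas L -> smooth_at k l -> smooth_at h l ->
  (\forall l' \near l, pg (k l') = pg (h l')) ->
  smooth_at (fun l => gmul GF (k l) (h l)) l.
Proof.
move=> aL sk sh kh.
exact: (smooth_on_comp aL (prod_atlas aG aG) aG (@gmul_smooth _ _ _ GF)
  (smooth_at_pair aL aG aG sk sh) kh).
Qed.

Lemma act_inv g x : pg g = p x -> act a (ginv GF g) (act a g x) = x.
Proof. by move=> gx; rewrite -actM ?ginvP// gmulVg gx act1. Qed.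

Section LocalCoordinates.
Context (x0 : X) (Phi : prod_space D (E q) -> G) (lam : G -> E q).
Local Notation z0 := (p x0).
Local Notation base := ((z0, 0 : 'rV[R]_q) : prod_space D (E q)).
Hypotheses (sPhi : smooth_at Phi base) (slam : smooth_at lam (e z0))
  (PhiK : \forall z \near base, pg (Phi z) = z.1 /\ lam (Phi z) = z.2)
  (lamK : \forall g \near e z0, Phi (pg g, lam g) = g)
  (lam1 : \forall z \near z0, lam (e z) = 0).

Lemma Phi_origin : Phi base = e z0.
Proof.
by have := nbhs_singleton lamK; rewrite goneP (nbhs_singleton lam1).
Qed.

Lemma near_Phi_one : \forall z \near z0, Phi (z, 0 : 'rV[R]_q) = e z.
Proof.
have := near_continuous (smooth_at_continuous (smooth_smooth_at z0 (gone_smooth GF))) lamK.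
by apply: filterS2 lam1 => z l0; rewrite goneP l0.
Qed.

(** The group element depends on the moved point because it has to be taken in
    the fibre over the projection of that point. *)
Definition local_act (v : E q) (x : X) : X := act a (Phi (p x, v)) x.

(** The argument [(p x, v)] of [Phi] has projection [p x] under the group family, so
    the action is evaluated inside the fibre product. *)
Lemma local_act_smooth_at (L : chartedSpace R) (v : L -> E q) (f : L -> X) l :
  smooth_atlas L -> smooth_at v l -> smooth_at f l ->
  smooth_at Phi (p (f l), v l) ->
  (\forall z \near ((p (f l), v l) : prod_space D (E q)), pg (Phi z) = z.1) ->
  smooth_at (fun l => local_act (v l) (f l)) l.
Proof.
move=> aL sv sf sP pP.
have spf : smooth_at (fun l => p (f l)) l.
  by apply: (smooth_at_comp aL aX aD sf); exact: family_smooth_at.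
have spv := smooth_at_pair aL aD (aE q) spf sv.
apply: act_smooth_at => //.
  exact: (smooth_at_comp aL (prod_atlas aD (aE q)) aG spv sP).
exact: (near_continuous (smooth_at_continuous spv) pP).
Qed.

Lemma local_act_smooth_base (L : chartedSpace R) (v : L -> E q) (f : L -> X) l :
  smooth_atlas L -> smooth_at v l -> smooth_at f l -> f l = x0 -> v l = 0 ->
  smooth_at (fun l => local_act (v l) (f l)) l.
Proof.
move=> aL sv sf fl vl; apply: local_act_smooth_at => //; rewrite fl vl//.
by apply: filterS PhiK => z [].
Qed.

Lemma fibre_inclusion_smooth_at (v : E q) :
  smooth_at (fun v : E q => (z0, v) : prod_space D (E q)) v.
Proof.
apply: smooth_at_pair => //; last exact: smooth_at_id.
exact: smooth_at_cst.
Qed.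

Lemma near_fibre (P : set (prod_space D (E q))) : (\forall z \near base, P z) ->
  \forall v \near (0 : 'rV[R]_q), P (z0, v).
Proof.
exact: (near_continuous (smooth_at_continuous (fibre_inclusion_smooth_at 0))).
Qed.

Lemma local_act0 : local_act 0 x0 = x0.
Proof. by rewrite /local_act Phi_origin act1. Qed.

(** Translation by the group conjugates the orbit map near any point to the
    orbit map near the identity, hence its rank is at most the rank at the
    identity. By freeness it is moreover injective, and an injective map of
    locally constant rank is an immersion. *)
Lemma orbit_map_immersion c : free_action a -> atlas X c -> cdom c x0 ->
  row_free (jacobian (fun v : 'rV[R]_q => cmap c (local_act v x0)) 0).
Proof.
move=> fr Xc cx0; have [chX _ _] := aX; have hc := chX _ Xc.
pose f (v : E q) : E (mdim X) := cmap c (local_act v x0).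
have st v : smooth_at Phi (z0, v) ->
    (\forall z \near ((z0, v) : prod_space D (E q)), pg (Phi z) = z.1) ->
    smooth_at (local_act^~ x0) v.
  move=> sP pP; apply: (local_act_smooth_at (f := fun=> x0)) => //.
    exact: smooth_at_id.
  exact: smooth_at_cst.
have PhiK1 : \forall z \near base, pg (Phi z) = z.1.
  by apply: filterS PhiK => z [].
have st0 : smooth_at (local_act^~ x0) 0 by exact: st.
have n1 := near_fibre (smooth_at_near sPhi).
have n2 := near_fibre (nbhs_interior PhiK1).
have n3 := near_fibre PhiK.
have n4 : \forall v \near (0 : 'rV[R]_q), cdom c (local_act v x0).
  apply: (near_continuous (smooth_at_continuous st0)).
  by rewrite local_act0; exact: near_cdom.
have sf v : smooth_at (local_act^~ x0) v -> cdom c (local_act v x0) ->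
    germ (f : 'rV[R]_q -> _) v.
  move=> sv cv; apply/smooth_at_euclid.
  by apply: (smooth_at_comp (aE q) aX (aE _) sv); exact: smooth_at_cmap.
apply: isolated_fibre_immersion.
- by apply: sf => //; rewrite local_act0.
- near=> v1.
  have sP1 : smooth_at Phi (z0, v1) by near: v1; exact: n1.
  have pP1 : \forall z \near ((z0, v1) : prod_space D (E q)), pg (Phi z) = z.1.
    by near: v1; exact: n2.
  have [pg1 lam1'] : pg (Phi (z0, v1)) = z0 /\ lam (Phi (z0, v1)) = v1.
    by near: v1; exact: n3.
  have cv1 : cdom c (local_act v1 x0) by near: v1; exact: n4.
  set g1 := Phi (z0, v1) in pg1 lam1'.
  have sPv : @smooth_at R (E q) G (fun v => Phi (z0, v)) v1.
    exact: (smooth_at_comp (aE q) (prod_atlas aD (aE q)) aG (fibre_inclusion_smooth_at v1) sP1).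
  have pPv : \forall v \near (v1 : E q), pg (Phi (z0, v)) = z0.
    exact: (near_continuous (smooth_at_continuous (fibre_inclusion_smooth_at v1)) pP1).
  pose k (v : E q) := gmul GF (ginv GF g1) (Phi (z0, v)).
  have sk : smooth_at k v1.
    apply: gmul_smooth_at => //; first exact: smooth_at_cst.
    by apply: filterS pPv => v ->; rewrite ginvP.
  have k1 : k v1 = e z0 by rewrite /k gmulVg pg1.
  have kK0 : \forall g \near k v1, Phi (pg g, lam g) = g by rewrite k1.
  have kK := near_continuous (smooth_at_continuous sk) kK0.
  pose tau : E q -> E q := lam \o k.
  have tau1 : tau v1 = 0 by rewrite /tau/= k1; exact: nbhs_singleton lam1.
  have gtau : germ (tau : 'rV[R]_q -> 'rV[R]_q) v1.
    apply/smooth_at_euclid; apply: (smooth_at_comp (aE q) aG (aE q) sk).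
    by rewrite k1.
  pose T (x : X) := local_act v1 x.
  have sT : smooth_at T x0.
    apply: (local_act_smooth_at (v := fun=> v1) (f := id)) => //; last exact: smooth_at_id.
    exact: smooth_at_cst.
  have Tx0 : T x0 = local_act v1 x0 by [].
  have gT : germ (in_charts T c c) (f (tau v1)).
    by rewrite tau1 /f local_act0; exact: smooth_at_germ sT _ _ _ _.
  have gf0 : germ (f : 'rV[R]_q -> _) (tau v1).
    by rewrite tau1; apply: sf => //; rewrite local_act0.
  have E1 : \forall v \near (v1 : E q), (in_charts T c c \o (f \o tau)) v = f v.
    have n5 : \forall v \near (v1 : E q), cdom c (local_act (tau v) x0).
      have H : \forall w \near (tau v1 : E q), cdom c (local_act w x0).
        by rewrite tau1; exact: n4.
      exact: (near_continuous (germ_continuous gtau) H).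
    apply: filterS3 n5 pPv kK => v cv pv kv.
    rewrite /in_charts/= /f (chartK hc)//; congr (cmap c _).
    have pk : pg (k v) = z0 by rewrite /k gmulP ginvP ?pg1 ?pv.
    have kv' : Phi (z0, tau v) = k v by rewrite -[RHS]kv pk.
    rewrite /T /local_act kv' actP ?pk// -/g1 -actM ?pk//.
    by rewrite /k gmulA ?ginvP ?pg1 ?pv// gmulgV pg1 -{1}pv gmul1g.
  have df0 := germ_differentiable gf0; have dT := germ_differentiable gT.
  have dtau := germ_differentiable gtau.
  have dft : differentiable (f \o tau : 'rV[R]_q -> _) v1 by exact: differentiable_comp.
  rewrite -(near_eq_jacobian E1 (differentiable_comp dft dT)).
  rewrite (jacobian_comp dft dT) (jacobian_comp dtau df0) tau1 -mulmxA.
  exact: leq_trans (mxrankM_maxr _ _) (mxrankM_maxl _ _).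
- apply: filterS2 n3 n4 => v [/= pv lv] cv; rewrite local_act0 => fv.
  have E1 : local_act v x0 = x0 by rewrite -[LHS](chartK hc)// fv chartK.
  have [z _ ez] := fr _ _ pv E1.
  have zz : z = z0 by rewrite -[RHS]pv -ez goneP.
  by rewrite -lv /= -ez zz; exact: nbhs_singleton lam1.
Unshelve. all: by end_near. Qed.

End LocalCoordinates.

End Actions.

(** * Proper actions *)

(** The image of a closed ball under the inverse of a chart. *)
Lemma manifold_locally_compact (R : realType) (M : chartedSpace R) (x : M) :
  smooth_atlas M -> exists2 K, compact K & nbhs x K.
Proof.
move=> aM; have [chM coM _] := aM; have [c Mc cx] := coM x.
have hc := chM _ Mc; have /nbhs_closedballP[r Br] := near_cimg hc (cimg_cmap cx).
exists (cinv c @` closed_ball (cmap c x) r%:num).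
  apply: continuous_compact; last first.
    apply: bounded_closed_compact; last exact: closed_ball_closed.
    exists (`|cmap c x| + r%:num); split; first exact: num_real.
    move=> N xN z; rewrite closed_ballE// /closed_ball_/= => zK.
    apply/ltW/le_lt_trans/xN.
    have -> : z = cmap c x - (cmap c x - z) by rewrite opprB addrC subrK.
    by apply: le_trans (ler_normB _ _) _; rewrite lerD2l.
  apply: continuous_in_subspaceT => z /[!inE] /Br cz.
  exact: cinv_continuous.
have Bx : \forall y \near cmap c x, closed_ball (cmap c x) r%:num y.
  by apply/nbhs_closedballP; exists r.
apply: filterS2 (near_cdom hc cx) (near_continuous (cmap_continuous hc cx) Bx).
by move=> z cz Bz; exists (cmap c z) => //; exact: chartK.
Qed.

Section Properness.
Context (R : realType) (D G X : chartedSpace R) (GF : group_family D G)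
  (p : X -> D) (Xfam : smooth_family p) (a : family_action GF p).

Local Notation pg := (gproj GF).
Local Notation S := (fiber_product pg p).

Let aX : smooth_atlas X.
Proof. by have [mX _ _] := Xfam; exact: smooth_manifold_atlas. Qed.

(** The action is only constrained on the fibre product, hence continuous only
    relative to it. *)
Lemma act_continuous_on (z : G * X) (B : set X) : S z -> nbhs (act a z.1 z.2) B ->
  \forall z' \near z, S z' -> B (act a z'.1 z'.2).
Proof.
move=> Sz Bz; have [U [F [Uz [oU cF _] FE]]] := act_smooth a Sz.
have FBz : nbhs (F z) B by rewrite FE.
have n1 : nbhs z (F @^-1` B) by exact: (cF z Uz _ FBz).
have n2 : nbhs z U by exact: (open_nbhs_nbhs (conj oU Uz)).
have FF := @nbhs_filter (G * X)%type z.
apply: (@filterS2 _ _ FF _ _ _ _ n1 n2) => z' FB Uz' Sz'.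
by rewrite -(FE _ Sz' Uz').
Qed.

(** Group elements moving points near [x] to points near [y] stay in a compact
    set, hence accumulate only at elements moving [x] to [y]. With an empty [W]
    this separates distinct orbits, and with [x = y] and a free action it says
    that elements moving points near [x] to points near [x] are near 1. *)
Lemma proper_near (x y : X) (W : set G) : proper_action a ->
  (forall g, pg g = p x -> act a g x = y -> nbhs g W) ->
  exists U V, [/\ nbhs x U, nbhs y V &
    forall g u, pg g = p u -> U u -> V (act a g u) -> W g].
Proof.
move=> [_ prop] HW; apply: contrapT => nUV.
have [[hX _ _ _ _] [hD _ _ _ _] _] := Xfam.
have [K cK Kx] := manifold_locally_compact x aX.
have [L cL Ly] := manifold_locally_compact y aX.
pose f (z : G * X) := (z.2, act a z.1 z.2).
have cdiag : closed (fiber_product p p : set (X * X)).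
  have -> : fiber_product p p = (fun z : X * X => (p z.1, p z.2)) @^-1` [set z | z.1 = z.2].
    by [].
  apply: closed_comp; last exact: hausdorff_closed_diagonal.
  move=> z _; have cp w := smooth_at_continuous (family_smooth_at Xfam w).
  apply: continuous_pair.
    by apply: (@continuous_comp _ _ _ fst p); [exact: cvg_fst|exact: cp].
  by apply: (@continuous_comp _ _ _ snd p); [exact: cvg_snd|exact: cp].
pose KL := (K `*` L) `&` fiber_product p p.
have cKL : compact KL by apply: compact_closedI => //; exact: compact_setX.
have cC : compact (S `&` f @^-1` KL) by apply: prop => // z [].
pose B (UV : set X * set X) :=
  [set z : G * X | [/\ S z, UV.1 z.2, UV.2 (act a z.1 z.2) & ~ W z.1]].
pose I := [set UV : set X * set X | nbhs x UV.1 /\ nbhs y UV.2].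
have BI : forall UV UV', I UV -> I UV' ->
    exists2 UV'', I UV'' & B UV'' `<=` B UV `&` B UV'.
  move=> [U V] [U' V'] [/= xU yV] [/= xU' yV']; exists (U `&` U', V `&` V').
    by split; exact: filterI.
  by move=> z [/= Sz [? ?] [? ?] nW].
have FB : Filter (filter_from I B).
  by apply: filter_from_filter => //; exists (setT, setT); split; exact: filterT.
have PF : ProperFilter (filter_from I B).
  apply: filter_from_proper => // -[U V] [/= xU yV].
  apply: contrapT => nB; apply: nUV; exists U, V; split=> // g u gu Uu Vu.
  by apply: contrapT => nW; apply: nB; exists (g, u).
have FC : filter_from I B (S `&` f @^-1` KL).
  exists (K, L) => // -[g u] [/= Sz Ku Lu _]; split=> //; split=> //.
  by rewrite /fiber_product/= actP.
have [[g u] [[Sgu _] cl]] := cC _ PF FC.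
have clB UV A : I UV -> nbhs (g, u) A -> exists z, B UV z /\ A z.
  move=> IUV Agu; have [|z [Bz Az]] := cl (B UV) A _ Agu; first by exists UV.
  by exists z.
have ux : u = x.
  apply/esym; apply: hX => A A' xA uA'.
  have n1 : nbhs (g, u) (setT `*` A').
    by apply: nbhs_setX => //; exact: filterT.
  have [|[g' u'] [[_ /= Au' _ _] [_ A'u']]] := clB (A, setT) _ _ n1.
    by split=> //; exact: filterT.
  by exists u'.
have guy : act a g u = y.
  apply/esym; apply: hX => A A' yA gA'.
  have n1 := act_continuous_on (z := (g, u)) Sgu gA'.
  have [|[g' u'] [[Sz /= _ Au' _] A'u']] := clB (setT, A) _ _ n1.
    by split=> //; exact: filterT.
  by exists (act a g' u'); split=> //; exact: A'u'.
have gW : nbhs g W by apply: HW; rewrite -ux.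
have n1 : nbhs (g, u) (W `*` setT).
  by apply: nbhs_setX => //; exact: filterT.
have [|[g' u'] [[_ _ _ nW] [/= ? _]]] := clB (setT, setT) _ _ n1.
  by split; exact: filterT.
exact: nW.
Qed.

End Properness.

(** * Slices *)

Section Slices.
Context (R : realType) (D G X : chartedSpace R) (GF : group_family D G)
  (p : X -> D) (Xfam : smooth_family p) (a : family_action GF p).

Local Notation E := (euclid R).
Local Notation q := (mdim G - mdim D)%N.
Local Notation k := (mdim X - q)%N.
Local Notation pg := (gproj GF).
Local Notation e := (gone GF).

Let aG : smooth_atlas G. Proof. by have [] := group_family_atlas GF. Qed.
Let aD : smooth_atlas D. Proof. by have [] := group_family_atlas GF. Qed.
Let aX : smooth_atlas X.
Proof. by have [mX _ _] := Xfam; exact: smooth_manifold_atlas. Qed.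
Let aE n : smooth_atlas (E n). Proof. exact: euclid_atlas. Qed.

Definition same_orbit (x y : X) : Prop := exists2 g, pg g = p x & y = act a g x.

Lemma same_orbit_sym x y : same_orbit x y -> same_orbit y x.
Proof.
move=> [g gx ->]; exists (ginv GF g); first by rewrite ginvP actP.
by rewrite act_inv.
Qed.

Lemma same_orbit_trans y x z : same_orbit x y -> same_orbit y z -> same_orbit x z.
Proof.
move=> [g gx ->] [h hx ->]; rewrite actP// in hx.
by exists (gmul GF h g); [rewrite gmulP ?hx ?gx|rewrite actM].
Qed.

(** The image of [V] under [s] is a slice that meets every orbit through [U] exactly once
    in [U], and [phi] sends a point of [U] to the parameter of its orbit. *)
Definition is_slice (U : set X) (phi : X -> E k) (V : set (E k)) (s : E k -> X) :=
  [/\ open U /\ (forall x, U x -> smooth_at phi x),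
      open V /\ (forall v, V v -> smooth_at s v),
      forall x, U x -> V (phi x) /\ same_orbit (s (phi x)) x,
      forall v, V v -> U (s v) /\ phi (s v) = v &
      forall x y, U x -> U y -> same_orbit x y -> phi x = phi y].

(** Choose a complement [K] of the tangent space [T] of the orbit of [x0], in a chart
    [c]. Then the map [Th], which moves the point of the slice with parameter [y]
    by the group element with coordinate [v], is a local diffeomorphism at 0, so
    every orbit near [x0] meets the slice. If two points of the slice near [x0] are
    in the same orbit, then by properness and freeness they differ by a group element
    near 1, which has a small coordinate [v]; then [Th (v, y) = Th (0, y')], and the
    injectivity of [Th] gives [y = y']. *)
Lemma slice_exists (x0 : X) : proper_action a -> free_action a ->
  exists U phi V s, U x0 /\ is_slice U phi V s.
Proof.
move=> prop fr; set z0 := p x0.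
have [Phi [lam [sPhi slam PhiK lamK lam1]]] := group_coordinates GF z0.
have [chX coX _] := aX; have [c Xc cx0] := coX x0; have hc := chX _ Xc.
set u0 := cmap c x0.
pose f (v : 'rV[R]_q) : 'rV[R]_(mdim X) := cmap c (local_act a Phi v x0).
set T := jacobian f 0.
have freeT : row_free T by exact: (orbit_map_immersion Xfam sPhi slam PhiK lamK lam1 fr Xc cx0).
have TM : T *m pinvmx T = 1%:M by exact: mulmxVp.
have [K [L [KM KL TL MTLK]]] := kernel_complement TM.
set M := pinvmx T in TM KM MTLK.
(* [s] is the slice, and [Th] moves its points by group elements near 1. *)
pose l (y : E k) : E (mdim X) := y *m K + u0.
pose s (y : E k) : X := cinv c (l y).
pose Th (w : 'rV[R]_(q + k)) : 'rV[R]_(mdim X) :=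
  cmap c (local_act a Phi (lsubmx w) (s (rsubmx w))).
have l0 : l 0 = u0 by rewrite /l mul0mx add0r.
have s0 : s 0 = x0 by rewrite /s l0 chartK.
have gl y : germ (l : 'rV[R]_k -> _) y.
  by apply: germD; [exact: germ_mulmx|exact: germ_cst].
have ss y : cimg c (l y) -> smooth_at s y.
  move=> cy; apply: (smooth_at_comp (f := l) (aE _) (aE _) aX).
    exact/smooth_at_euclid.
  exact: smooth_at_cinv.
have cu0 : cimg c u0 by exact: cimg_cmap.
have act0 : local_act a Phi 0 x0 = x0 by exact: (local_act0 a lamK lam1).
have sTh : germ Th 0.
  apply/(@smooth_at_euclid _ _ _ Th).
  apply: (smooth_at_comp (M := E (q + k)) (f := fun w => local_act a Phi (lsubmx w) (s (rsubmx w)))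
    (g := cmap c : X -> E (mdim X)) (aE _) aX (aE _)); last first.
    by apply: smooth_at_cmap; rewrite //= ?linear0 s0 act0.
  apply: (local_act_smooth_base Xfam a sPhi PhiK) => //.
  - by apply/smooth_at_euclid; exact: germ_lsubmx.
  - apply: (smooth_at_comp (f := @rsubmx R 1 q k : E (q + k) -> E k) (aE _) (aE _) aX).
      by apply/smooth_at_euclid; exact: germ_rsubmx.
    by apply: ss; rewrite linear0 l0.
  - by rewrite linear0.
  - by rewrite linear0.
have Th0 : Th 0 = u0 by rewrite /Th !linear0 s0 act0.
have near_s (P : set X) : (\forall x \near x0, P x) -> \forall y \near (0 : E k), P (s y).
  move=> HP; apply: (near_continuous (smooth_at_continuous (ss 0 _))); rewrite ?l0//.
  by rewrite s0.
have near_l (P : set (E (mdim X))) : (\forall u \near u0, P u) ->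
    \forall y \near (0 : E k), P (l y).
  by move=> HP; apply: (near_continuous (germ_continuous (gl 0))); rewrite l0.
have unit_act : \forall x \near x0, local_act a Phi 0 x = x.
  have cp := smooth_at_continuous (family_smooth_at Xfam x0).
  have := near_continuous cp (near_Phi_one lamK lam1).
  by apply: filterS => x; rewrite /local_act => ->; rewrite act1.
have Thl : \forall y \near (0 : 'rV[R]_k), Th (row_mx 0 y) = l y.
  have := near_l _ (near_cimg hc cu0).
  apply: filterS2 (near_s _ unit_act) => y y1 y2.
  by rewrite /Th row_mxKl row_mxKr y1 /s (cinvK hc).
have dTh := germ_differentiable sTh.
have JTh : jacobian Th 0 = col_mx T K.
  have i1 : row_mx 1%:M 0 *m jacobian Th 0 = T.
    have d1 : differentiable (fun v : 'rV[R]_q => v *m row_mx 1%:M (0 : 'M[R]_(q, k))) 0.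
      by have [] := mulmx_diff (row_mx 1%:M (0 : 'M[R]_(q, k))) (0 : 'rV[R]_q).
    have d2 : differentiable Th ((0 : 'rV[R]_q) *m row_mx 1%:M (0 : 'M[R]_(q, k))).
      by rewrite mul0mx.
    have := jacobian_comp d1 d2; rewrite jacobian_mulmx mul0mx => <-.
    congr (jacobian _ _); apply/funext => v /=.
    by rewrite /Th mul_mx_row mulmx1 mulmx0 row_mxKl row_mxKr s0.
  have i2 : row_mx 0 1%:M *m jacobian Th 0 = K.
    have d1 : differentiable (fun v : 'rV[R]_k => v *m row_mx (0 : 'M[R]_(k, q)) 1%:M) 0.
      by have [] := mulmx_diff (row_mx (0 : 'M[R]_(k, q)) 1%:M) (0 : 'rV[R]_k).
    have d2 : differentiable Th ((0 : 'rV[R]_k) *m row_mx (0 : 'M[R]_(k, q)) 1%:M).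
      by rewrite mul0mx.
    have := jacobian_comp d1 d2; rewrite jacobian_mulmx mul0mx => <-.
    have -> : K = jacobian (l : 'rV[R]_k -> _) 0.
      rewrite /l jacobianD; [|exact/germ_differentiable/germ_mulmx|exact: differentiable_cst].
      by rewrite jacobian_mulmx jacobian_cst addr0.
    apply: near_eq_jacobian; last exact: differentiable_comp.
    apply: filterS Thl => y <- /=.
    by rewrite mul_mx_row mulmx1 mulmx0.
  rewrite -i1 -i2 -mul_col_mx.
  have -> : col_mx (row_mx 1%:M 0) (row_mx 0 1%:M) = 1%:M :> 'M[R]_(q + k).
    by rewrite -[LHS]/(block_mx 1%:M 0 0 1%:M) -scalar_mx_block.
  by rewrite mul1mx.
have [||h [gh h0 hTh Thh]] := germ_inverse sTh (B := row_mx M L).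
- by rewrite JTh mul_col_row TM TL KM KL -scalar_mx_block.
- by rewrite JTh mul_row_col.
rewrite Th0 in gh h0 Thh.
pose coord (x : X) : E (q + k) := h (cmap c x).
pose phi (x : X) : E k := rsubmx (coord x).
have coord0 : coord x0 = 0 by exact: h0.
have phi0 : phi x0 = 0 by rewrite /phi coord0 linear0.
have scoord x : cdom c x -> germ h (cmap c x) -> smooth_at coord x.
  move=> cx gx; apply: (smooth_at_comp aX (aE _) (aE _)).
    exact: (smooth_at_cmap aX Xc cx).
  exact/smooth_at_euclid.
have sphi x : cdom c x -> germ h (cmap c x) -> smooth_at phi x.
  move=> cx gx; apply: (smooth_at_comp (g := @rsubmx R 1 q k : E (q + k) -> E k) aX (aE _) (aE _)).
    exact: scoord.
  by apply/smooth_at_euclid; exact: germ_rsubmx.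
have /nbhs_ballP[r /= r0 Br] : \forall w \near (0 : 'rV[R]_(q + k)), h (Th w) = w := hTh.
have r20 : 0 < r / 2 by rewrite divr_gt0.
have Brow (v : 'rV[R]_q) (y : 'rV[R]_k) : `|v| <= r / 2 -> `|y| <= r / 2 ->
    h (Th (row_mx v y)) = row_mx v y.
  move=> vr yr; apply: Br; rewrite -ball_normE /ball_/= sub0r normrN.
  by apply: le_lt_trans (norm_row_mx_le vr yr) _; lra.
have near0 m : \forall v \near (0 : 'rV[R]_m), `|v| <= r / 2.
  apply/nbhs_ballP; exists (r / 2) => // v; rewrite -ball_normE /ball_/= sub0r normrN.
  exact: ltW.
(* By properness, [W] contains the elements moving a point near [x0] to a point
   near [x0]. *)
pose W := [set g | Phi (pg g, lam g) = g /\ `|lam g : 'rV[R]_q| <= r / 2].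
have nW : nbhs (e z0) W.
  have l1 := nbhs_singleton lam1.
  have n1 : \forall g \near e z0, `|lam g : 'rV[R]_q| <= r / 2.
    apply: (near_continuous (P := [set v : E q | `|v : 'rV[R]_q| <= r / 2])
      (smooth_at_continuous slam)).
    by rewrite l1; exact: near0.
  by apply: filterS2 lamK n1.
have [g gx0 gx|A [B [xA xB AB]]] := @proper_near _ _ _ _ _ _ Xfam a x0 x0 W prop.
  have [z _ ez] := fr _ _ gx0 gx.
  by rewrite -ez; have := gx0; rewrite -ez goneP => ->.
have nY : \forall y \near (0 : E k),
    [/\ `|y : 'rV[R]_k| <= r / 2, cimg c (l y), A (s y), B (s y) &
        Th (row_mx 0 y) = l y].
  have n1 := near_l _ (near_cimg hc cu0).
  have FF := @nbhs_filter (E k) (0 : 'rV[R]_k).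
  have n2 := @filterI _ _ FF _ _ (near_s _ xA) (near_s _ xB).
  have n3 := @filterI _ _ FF _ _ (near0 k) Thl.
  by apply: (@filterS3 _ _ FF _ _ _ _ _ n1 n2 n3) => y ? [? ?] [].
have [Y0 [oY0 Y00] Y0P] := open_near nY.
have nX : \forall x \near x0, [/\ cdom c x, germ h (cmap c x), Th (coord x) = cmap c x,
    cdom c (local_act a Phi (lsubmx (coord x)) (s (phi x))) &
    pg (Phi (p (s (phi x)), lsubmx (coord x))) = p (s (phi x))].
  have sh0 : smooth_at coord x0 by exact: scoord.
  have sphi0 : smooth_at phi x0 by exact: sphi.
  have ssphi : smooth_at (s \o phi) x0.
    by apply: (smooth_at_comp aX (aE _) aX) => //; apply: ss; rewrite phi0 l0.
  have slh : smooth_at (fun x => lsubmx (coord x) : E q) x0.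
    apply: (smooth_at_comp (g := @lsubmx R 1 q k : E (q + k) -> E q) aX (aE _) (aE _)) => //.
    by apply/smooth_at_euclid; exact: germ_lsubmx.
  have n1 := near_cdom hc cx0.
  have n2 := near_continuous (cmap_continuous hc cx0) (germ_near gh).
  have n3 := near_continuous (cmap_continuous hc cx0) Thh.
  have n4 : \forall x \near x0,
      cdom c (local_act a Phi (lsubmx (coord x)) (s (phi x))).
    have sla : smooth_at (fun x => local_act a Phi (lsubmx (coord x)) (s (phi x))) x0.
      apply: (local_act_smooth_base Xfam a sPhi PhiK) => //.
        by rewrite phi0 s0.
      by rewrite coord0 linear0.
    apply: (near_continuous (smooth_at_continuous sla)).
    by rewrite phi0 s0 coord0 linear0 act0; exact: near_cdom.
  have n5 : \forall x \near x0,
      pg (Phi (p (s (phi x)), lsubmx (coord x))) = p (s (phi x)).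
    have sps : smooth_at (fun x => p (s (phi x))) x0.
      by apply: (smooth_at_comp aX aX aD ssphi); exact: family_smooth_at.
    have spair := smooth_at_pair aX aD (aE q) sps slh.
    have PhiK' : \forall z \near ((p (s (phi x0)), lsubmx (coord x0)) : prod_space D (E q)),
        pg (Phi z) = z.1.
      by rewrite phi0 s0 coord0 linear0; apply: filterS PhiK => z [].
    exact: (near_continuous (smooth_at_continuous spair) PhiK').
  have FF := @nbhs_filter X x0.
  apply: (@filterS3 _ _ FF _ _ _ _ _ (filterI n1 n2) (filterI n3 n4) n5).
  by move=> x [? ?] [? ?] ?.
have [U1 [oU1 U10] U1P] := open_near nX.
have sphiU x : U1 x -> smooth_at phi x.
  by move=> /U1P[cx gx _ _ _]; exact: sphi.
have ssY y : Y0 y -> smooth_at s y by move=> /Y0P[_ cy _ _ _]; exact: ss.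
have phis y : Y0 y -> phi (s y) = y.
  move=> /Y0P[yr cy _ _ Ty]; rewrite /phi /coord /s (cinvK hc)//.
  by rewrite -Ty Brow ?row_mxKr// normr0 ltW.
have orb x : U1 x -> same_orbit (s (phi x)) x.
  move=> /U1P[cx _ Tx cl pgx]; exists (Phi (p (s (phi x)), lsubmx (coord x))) => //.
  by rewrite -[LHS](chartK hc cx) -Tx /Th -/(phi x) (chartK hc cl).
(* Shrinking in this order makes [phi] and [s] exchange [U] and [V]: for [v] in [Y0],
   the point [s v] has parameter [v], hence lies in [U] as soon as it lies in [U1]. *)
pose V := Y0 `&` s @^-1` U1.
pose U := U1 `&` phi @^-1` V.
have oV : open V.
  exact: (open_setI_preimage oY0 oU1 (fun y Yy => smooth_at_continuous (ssY y Yy))).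
have oU : open U.
  exact: (open_setI_preimage oU1 oV (fun x Ux => smooth_at_continuous (sphiU x Ux))).
exists U, phi, V, s; split; first by split=> //; split; rewrite /= phi0// s0.
split.
- by split=> // x [/sphiU].
- by split=> // v [/ssY].
- by move=> x [Ux Vx]; split=> //; exact: orb.
- move=> v Vv; have [Yv Uv] := Vv; have E1 := phis _ Yv; split=> //.
  by split=> //=; rewrite E1.
- move=> x y [Ux [Yx _]] [Uy [Yy _]] xy.
  have [g gs Eg] : same_orbit (s (phi x)) (s (phi y)).
    apply: same_orbit_trans (orb _ Ux) _; apply: same_orbit_trans xy _.
    exact: same_orbit_sym (orb _ Uy).
  have [xr cx Ax _ Tx] := Y0P _ Yx; have [yr cy _ By Ty] := Y0P _ Yy.
  have [Wg1 Wg2] : W g by apply: (AB g (s (phi x))) => //; rewrite -Eg.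
  have E1 : Th (row_mx (lam g) (phi x)) = Th (row_mx 0 (phi y)).
    rewrite Ty /Th row_mxKl row_mxKr /local_act -gs Wg1 -Eg.
    by rewrite /s (cinvK hc).
  have r0' : `|0 : 'rV[R]_q| <= r / 2 by rewrite normr0 ltW.
  by have := congr1 h E1; rewrite (Brow _ _ Wg2 xr) (Brow _ _ r0' yr) => /eq_row_mx[].
Qed.

End Slices.

(** * The orbit space *)

Section Quotient.
Context (R : realType) (D G X : chartedSpace R) (GF : group_family D G)
  (p : X -> D) (Xfam : smooth_family p) (a : family_action GF p)
  (a_proper : proper_action a) (a_free : free_action a).

Local Notation E := (euclid R).
Local Notation k := (mdim X - (mdim G - mdim D))%N.
Local Notation pg := (gproj GF).
Local Notation Q := (orbit_space a).
Local Notation pi := (orbit_proj a).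

Let aG : smooth_atlas G. Proof. by have [] := group_family_atlas GF. Qed.
Let aD : smooth_atlas D. Proof. by have [] := group_family_atlas GF. Qed.
Let aX : smooth_atlas X.
Proof. by have [mX _ _] := Xfam; exact: smooth_manifold_atlas. Qed.
Let aE n : smooth_atlas (E n). Proof. exact: euclid_atlas. Qed.

Lemma orbit_projP x y : pi x = pi y <-> same_orbit a x y.
Proof.
split=> [xy|[g gx yg]].
  by have /eqmodP/asboolP := xy.
by apply/eqmodP/asboolP; exists g.
Qed.

Lemma orbit_proj_surj (z : Q) : exists x, pi x = z.
Proof. by exists (repr (z : {eq_quot orbit_equiv a}%qT)); exact: reprK. Qed.

Lemma open_orbit_space (A : set Q) : open (pi @^-1` A) -> open A.
Proof. by []. Qed.

Lemma orbit_proj_continuous : continuous pi.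
Proof. exact: pi_continuous. Qed.

(** Move by a group element that varies smoothly with the base point: the value at
    [p x] of a local section of the group family. *)
Lemma translation x y : same_orbit a x y -> exists t : X -> X,
  [/\ smooth_at t x, t x = y & \forall x' \near x, same_orbit a x' (t x')].
Proof.
move=> [g gx ->]; have [_ _ sub] := gproj_family GF.
have [s [ss sg ps]] := submersion_section g aG aD sub; rewrite gx in ss sg ps.
have sp := family_smooth_at Xfam x.
have psp := near_continuous (smooth_at_continuous sp) ps.
exists (fun x => act a (s (p x)) x); split; first last.
- by apply: filterS psp => x' px'; exists (s (p x')).
- by rewrite sg.
- apply: (act_smooth_at Xfam a (k := s \o p) (f := id)) => //.
    exact: (smooth_at_comp aX aD aG sp ss).
  exact: smooth_at_id.
Qed.

(** A point of the saturation of [U] is moved into [U] by a [translation], which moves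
    the nearby points into [U] as well. *)
Lemma orbit_proj_open (U : set X) : open U -> open (pi @` U).
Proof.
move=> oU; apply: open_orbit_space; rewrite openE => y [x Ux /orbit_projP].
move=> /same_orbit_sym /translation[t [st ty tO]].
have tU : \forall y' \near y, U (t y').
  apply: (near_continuous (smooth_at_continuous st)).
  by rewrite ty; exact: (open_nbhs_nbhs (conj oU Ux)).
apply: filterS2 tU tO => y' Uty yty; exists (t y') => //.
by apply/orbit_projP; exact: same_orbit_sym.
Qed.

Lemma orbit_proj_nbhs (x : X) (U : set X) : nbhs x U -> nbhs (pi x) (pi @` U).
Proof.
rewrite nbhsE => -[V [oV Vx] VU].
apply: filterS (open_nbhs_nbhs (conj (orbit_proj_open oV) _)).
  exact: image_subset.
by exists x.
Qed.

Lemma orbit_space_hausdorff : hausdorff_space Q.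
Proof.
move=> z w; have [x <-] := orbit_proj_surj z; have [y <-] := orbit_proj_surj w.
move=> cl; apply: contrapT => nxy.
have [|U [V [xU yV UV]]] := @proper_near _ _ _ _ _ _ Xfam a x y set0 a_proper.
  by move=> g gx gxy; case: nxy; apply/orbit_projP; exists g.
have [_ [[u Uu <-] [v Vv]]] := cl _ _ (orbit_proj_nbhs xU) (orbit_proj_nbhs yV).
move=> /esym/orbit_projP[g gu vg]; apply: (UV g u) => //.
by rewrite -vg.
Qed.

Lemma orbit_space_second_countable : @second_countable Q.
Proof.
have [[_ [B cB [oB bB]] _ _ _] _ _] := Xfam.
exists [set pi @` U | U in B]; first exact: sub_countable (card_image_le _ _) cB.
split=> [_ [U BU <-]|z A zA]; first exact/orbit_proj_open/oB.
have [x xz] := orbit_proj_surj z; rewrite -xz in zA *.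
have [U [BU Ux] UA] := bB x _ (orbit_proj_continuous zA).
exists (pi @` U); first by split; [exists U|exists x].
by move=> _ [y Uy <-]; exact: UA.
Qed.

(** An orbit has the parameter of any of its points in [U]; the default value of
    [xget] is only used for orbits outside the domain. *)
Definition slice_chart (U : set X) (phi : X -> E k) (s : E k -> X) : chart R Q k :=
  Chart (pi @` U)
    (fun z => phi (xget (repr (z : {eq_quot orbit_equiv a}%qT))
                        [set x | U x /\ pi x = z]))
    (pi \o s).

Definition orbit_atlas : set (chart R Q k) :=
  [set c | exists U phi V s, is_slice a U phi V s /\ c = slice_chart U phi s].

Definition orbit_manifold : chartedSpace R := @ChartedSpace R Q k orbit_atlas.

Section SliceChart.
Context (U : set X) (phi : X -> E k) (V : set (E k)) (s : E k -> X)
  (sl : is_slice a U phi V s).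
Local Notation c := (slice_chart U phi s).

Lemma slice_cmapE x : U x -> cmap c (pi x) = phi x.
Proof.
move=> Ux; rewrite /=; case: xgetP => [y _ [Uy yx]|/(_ x)[]//].
by have [_ _ _ _] := sl; apply=> //; exact/orbit_projP.
Qed.

Lemma slice_cinvE x : U x -> pi (s (phi x)) = pi x.
Proof. by have [_ _ + _ _] := sl => /[apply] -[_] /orbit_projP. Qed.

Lemma slice_cmap_inv v : V v -> cmap c (pi (s v)) = v.
Proof. by have [_ _ _ + _] := sl => /[apply] -[Us E1]; rewrite slice_cmapE. Qed.

Lemma slice_cimg : cimg c = V.
Proof.
apply/seteqP; split=> [_ [_ [x Ux <-] <-]|v Vv].
  by rewrite slice_cmapE//; have [_ _ + _ _] := sl => /(_ _ Ux)[].
exists (pi (s v)); last exact: slice_cmap_inv.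
by exists (s v) => //; have [_ _ _ + _] := sl => /(_ _ Vv)[].
Qed.

Lemma slice_is_chart : is_chart c.
Proof.
have [[oU sphi] [oV ss] slU slV _] := sl.
split; rewrite ?slice_cimg//.
- exact: orbit_proj_open.
- by move=> _ [x Ux <-]; rewrite slice_cmapE//; exact: slice_cinvE.
- move=> _ [x Ux <-] A; rewrite slice_cmapE// => Ax.
  have n1 : nbhs x (U `&` phi @^-1` A).
    apply: filterI; first exact: (open_nbhs_nbhs (conj oU Ux)).
    exact: (smooth_at_continuous (sphi x Ux) Ax).
  apply: filterS (orbit_proj_nbhs n1) => _ [y [Uy Ay] <-].
  by have : A (cmap c (pi y)) by rewrite slice_cmapE.
- move=> v Vv; apply: (@continuous_comp _ _ _ s pi).
    exact: (smooth_at_continuous (ss v Vv)).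
  exact: orbit_proj_continuous.
Qed.

(** The point [x] lies in the saturation of [U] but perhaps not in [U], where [phi]
    is smooth; a [translation] brings it there. *)
Lemma slice_cmap_smooth x : cdom c (pi x) ->
  @smooth_at R X (E k) (cmap c \o pi) x.
Proof.
have [[oU sphi] _ _ _ _] := sl.
move=> [y Uy /esym/orbit_projP/translation[t [st ty tO]]].
have sphit : smooth_at (phi \o t) x.
  by apply: (smooth_at_comp aX aX (aE k) st); rewrite ty; exact: sphi.
apply: (smooth_at_ext aX (aE k)) sphit.
have tU : \forall x' \near x, U (t x').
  apply: (near_continuous (smooth_at_continuous st)); rewrite ty.
  exact: (open_nbhs_nbhs (conj oU Uy)).
apply: filterS2 tU tO => x' Ut /orbit_projP Ex.
by rewrite /comp Ex slice_cmapE.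
Qed.

End SliceChart.

(** A change of charts is the parametrization [s] of one slice followed by the chart
    of the other, pulled back to [X]. *)
Lemma orbit_manifold_atlas : smooth_atlas orbit_manifold.
Proof.
split=> [_ [U [phi [V [s [sl ->]]]]]|z|].
- exact: slice_is_chart sl.
- have [x <-] := orbit_proj_surj z.
  have [U [phi [V [s [Ux sl]]]]] := slice_exists Xfam x a_proper a_free.
  by exists (slice_chart U phi s); [exists U, phi, V, s|exists x].
- move=> _ _ [U [phi [V [s [sl ->]]]]] [U' [phi' [V' [s' [sl' ->]]]]].
  apply: Cinfty_germ => _ [_ [[x Ux <-] c'x] <-].
  apply/(@smooth_at_euclid R k k); rewrite (slice_cmapE sl Ux).
  have [_ [_ ss] slU _ _] := sl; have [Vx sx] := slU _ Ux.
  apply: (smooth_at_comp (f := s) (g := cmap (slice_chart U' phi' s') \o pi : X -> E k)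
    (aE k) aX (aE k) (ss _ Vx)).
  by apply: (slice_cmap_smooth sl'); rewrite (slice_cinvE sl Ux).
Qed.

Let aQ := orbit_manifold_atlas.

Lemma orbit_manifold_smooth : smooth_manifold orbit_manifold.
Proof.
have [h1 h2 h3] := aQ; split=> //.
- exact: orbit_space_hausdorff.
- exact: orbit_space_second_countable.
Qed.

Lemma orbit_proj_smooth_at x : @smooth_at R X orbit_manifold pi x.
Proof.
have [chX coX _] := aX; have [c Xc cx] := coX x.
have [_ coQ _] := aQ; have [d Qd dx] := coQ (pi x).
apply: (germ_smooth_at aX aQ (c := c) (d := d)) => //.
  exact: orbit_proj_continuous.
apply/(@smooth_at_euclid R (mdim X) k).
have [U [phi [V [s [sl dE]]]]] := Qd; rewrite dE in dx *.
have sc : smooth_at (cinv c : E (mdim X) -> X) (cmap c x).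
  by apply: (smooth_at_cinv aX Xc); exact: cimg_cmap.
have sq : @smooth_at R X (E k) (cmap (slice_chart U phi s) \o pi) (cinv c (cmap c x)).
  by apply: (slice_cmap_smooth sl); rewrite (chartK (chX _ Xc)).
exact: (smooth_at_comp (aE _) aX (aE k) sc sq).
Qed.

(** The translate of the slice by a group element is a smooth section of the
    projection through [x], so that the projection is a submersion. *)
Lemma orbit_proj_family : @smooth_family R orbit_manifold X pi.
Proof.
have [mX _ _] := Xfam; split=> //; first exact: orbit_manifold_smooth.
split; first by apply: (smooth_at_open aX aQ openT) => x _; exact: orbit_proj_smooth_at.
move=> c d x Xc Qd cx dx.
have [U [phi [V [s [sl dE]]]]] := Qd.
have [y Uy yx] : cdom (slice_chart U phi s) (pi x) by rewrite -dE.
have [_ [oV ss] slU _ _] := sl; have [Vy _] := slU _ Uy.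
have : same_orbit a (s (phi y)) x.
  by apply/orbit_projP; rewrite (slice_cinvE sl Uy).
move=> /(translation)[t [st tx tO]].
have sts : smooth_at (t \o s) (phi y).
  exact: (smooth_at_comp (aE k) aX aX (ss _ Vy) st).
apply: (surjective_differential (t := t \o s) (v := phi y) aX aQ
  (orbit_proj_smooth_at x)) => //.
have E1 : \forall v \near (phi y : 'rV[R]_k), v = (cmap d \o pi \o (t \o s)) v.
  have Vn : \forall v \near (phi y : 'rV[R]_k), V v.
    exact: (open_nbhs_nbhs (conj oV Vy)).
  have tOs := near_continuous (smooth_at_continuous (ss _ Vy)) tO.
  apply: filterS2 Vn tOs => v Vv /orbit_projP Ev.
  by rewrite /comp -Ev dE (slice_cmap_inv sl).
have did := germ_differentiable (germ_id (phi y : 'rV[R]_k)).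
rewrite -(near_eq_jacobian E1 did) jacobian_id.
by rewrite /row_full mxrank1.
Qed.

Definition orbit_base (z : Q) : D := p (repr (z : {eq_quot orbit_equiv a}%qT)).

Lemma orbit_baseE x : p x = orbit_base (pi x).
Proof.
have : pi x = pi (repr (pi x : {eq_quot orbit_equiv a}%qT)).
  exact/esym/reprK.
by move=> /orbit_projP[g gx E1]; rewrite /orbit_base E1 actP.
Qed.

(** In a slice chart, the map from the orbit space to the base is [p] restricted to
    the slice. *)
Lemma orbit_base_smooth_at z : @smooth_at R orbit_manifold D orbit_base z.
Proof.
have [chD coD _] := aD; have [b Db bz] := coD (orbit_base z).
have [_ coQ _] := aQ; have [d Qd dz] := coQ z.
have cont : continuous orbit_base.
  apply/quotient_continuous => x.
  have -> : orbit_base \o \pi_(quotient_topology {eq_quot orbit_equiv a}%qT)%qT = p.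
    by apply/funext => y; rewrite [RHS]orbit_baseE.
  exact: (smooth_at_continuous (family_smooth_at Xfam x)).
apply: (germ_smooth_at aQ aD (c := d) (d := b)) => //; first exact: cont.
apply/(@smooth_at_euclid R k (mdim D)).
have [U [phi [V [s [sl dE]]]]] := Qd; rewrite dE in dz *.
have [x Ux xz] := dz; rewrite -xz (slice_cmapE sl Ux).
have [_ [oV ss] slU _ _] := sl; have [Vx _] := slU _ Ux.
have E1 : @in_charts R orbit_manifold D orbit_base (slice_chart U phi s) b
    = (cmap b \o (p \o s) : E k -> E (mdim D)).
  by apply/funext => v; rewrite /in_charts/= -orbit_baseE.
rewrite E1; have sps : smooth_at (p \o s) (phi x).
  by apply: (smooth_at_comp (aE k) aX aD (ss _ Vx)); exact: family_smooth_at.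
apply: (smooth_at_comp (aE k) aD (aE _) sps); apply: (smooth_at_cmap aD Db).
by rewrite /= orbit_baseE (slice_cinvE sl Ux) xz.
Qed.

(** Its differential is surjective because that of its composition with the
    orbit projection, which is [p], is. *)
Lemma orbit_base_family : @smooth_family R D orbit_manifold orbit_base.
Proof.
have [_ mD [_ sub]] := Xfam; split=> //; first exact: orbit_manifold_smooth.
split; first by apply: (smooth_at_open aQ aD openT) => z _; exact: orbit_base_smooth_at.
move=> d b z Qd Db dz bz; have [x xz] := orbit_proj_surj z.
have [chX coX _] := aX; have [c Xc cx] := coX x.
have scx : smooth_at (cinv c : E (mdim X) -> X) (cmap c x).
  by apply: (smooth_at_cinv aX Xc); exact: cimg_cmap.
have st : @smooth_at R (E (mdim X)) orbit_manifold (pi \o cinv c) (cmap c x).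
  exact: (smooth_at_comp (aE _) aX aQ scx (orbit_proj_smooth_at _)).
apply: (surjective_differential aQ aD (orbit_base_smooth_at z) st) => //.
  by rewrite /= (chartK (chX _ Xc)).
have -> : cmap b \o orbit_base \o (pi \o cinv c) = in_charts p c b.
  by apply/funext => v; rewrite /in_charts/= -orbit_baseE.
apply/full_jacobianP; apply: sub => //.
by rewrite orbit_baseE xz.
Qed.

End Quotient.

Theorem mainTheorem15 (R : realType) (D G X : chartedSpace R)
    (GF : group_family D G) (p : X -> D) (Xfam : smooth_family p)
    (a : family_action GF p)
    (a_proper : proper_action a) (a_free : free_action a) :
  exists (k : nat) (A : set (chart R (orbit_space a) k))
         (pbar : orbit_space a -> D),
    let XG := @ChartedSpace R (orbit_space a) k A in
    [/\ forall x, p x = pbar (orbit_proj a x),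
        @smooth_family R XG X (orbit_proj a) &
        @smooth_family R D XG pbar].
Proof.
exists (mdim X - (mdim G - mdim D))%N, (orbit_atlas (a := a)), (orbit_base (a := a)).
split; first exact: orbit_baseE.
- exact: orbit_proj_family.
- exact: orbit_base_family.
Qed.
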